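(* Let $G$ be a discrete group containing an infinite Abelian subgroup. Then $\triangle(\mathrm{B}_{0}(G))$ contains continuum many pairwise disjoint nonempty open sets. In particular, this space is not separable. The same conclusion holds true for $\triangle(\mathrm{B}(G))$.
   Context: For a discrete group $G$, $\mathrm{B}(G)$ is the Fourier--Stieltjes algebra: the linear span of positive definite functions on $G$, a commutative unital Banach algebra under pointwise multiplication with the norm of $\mathrm{B}(G)=C^{\ast}(G)^{\ast}$ (dual of the full group $C^*$-algebra). $\mathrm{B}_{0}(G):=\mathrm{B}(G)\cap c_{0}(G)$ is a closed ideal of $\mathrm{B}(G)$, considered as a commutative Banach algebra. For a commutative Banach algebra $A$, $\triangle(A)$ is the set of (nonzero) multiplicative linear functionals on $A$ with the weak$^*$ topology. *)

(* Defs.v *)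
From HB Require Import structures.
From mathcomp Require Import all_boot all_order all_algebra complex.
From mathcomp Require Import all_classical all_reals all_analysis.
From mathcomp Require Import ring.

Set Implicit Arguments.
Unset Strict Implicit.
Unset Printing Implicit Defensive.

Import Order.TTheory GRing.Theory Num.Theory.
Import numFieldNormedType.Exports.

Local Open Scope classical_set_scope.
Local Open Scope ring_scope.

Section positive_definite.
Variables (C : numClosedFieldType) (G : groupType).
Implicit Types p q : G -> C.

Definition positive_definite p : Prop :=
  forall (n : nat) (c : 'I_n -> C) (g : 'I_n -> G),
    0 <= \sum_(i < n) \sum_(j < n) c i * (c j)^* * p ((g j)^-1 * g i)%g.

Lemma positive_definite1 p : positive_definite p -> 0 <= p 1%g.
Proof.
move=> /(_ 1%N (fun=> 1) (fun=> 1%g)).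
by rewrite !big_ord_recl !big_ord0 !addr0 conjC1 !mul1r mulVg.
Qed.

Lemma positive_definiteV p x : positive_definite p -> p x^-1%g = (p x)^*.
Proof.
move=> pp; have p1 := positive_definite1 pp.
have key z : z * p x^-1%g + z^* * p x \is Num.real.
  have := pp 2%N (fun i => if i == ord0 then 1 else z)
                 (fun i => if i == ord0 then x else 1%g).
  rewrite !big_ord_recl !big_ord0 /= !addr0 !mulVg !mulg1 invg1 mul1g.
  rewrite conjC1 !mul1r mulr1 => /ger0_real sr.
  have -> : z * p x^-1%g + z^* * p x =
      p 1%g + z^* * p x + (z * p x^-1%g + z * z^* * p 1%g)
      - (p 1%g + z * z^* * p 1%g) by ring.
  apply: rpredB => //; apply: rpredD; apply: ger0_real => //.
  by rewrite mulr_ge0// mul_conjC_ge0.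
have /CrealP := key 1; have /CrealP := key 'i.
rewrite !rmorphD !rmorphM /= !conjCK !conjC1 conjCi !mul1r => e1 e2.
have {}e1 : 'i * ((p x^-1%g)^* - (p x)) = 'i * ((p x)^* - p x^-1%g).
  apply/eqP; rewrite -subr_eq0; apply/eqP.
  move/eqP : e1; rewrite -subr_eq0 => /eqP e1; rewrite -[RHS]oppr0 -[in RHS]e1.
  by ring.
move/(mulfI (neq0Ci _)) : e1 => e1.
have : 2 * (p x^-1%g) = 2 * (p x)^*.
  have -> : 2 * p x^-1%g = (p x^-1%g + p x) + (p x^-1%g - p x) by ring.
  rewrite -e2.
  have -> : 2 * (p x)^* = (p x)^* + (p x)^* by ring.
  apply/eqP; rewrite -subr_eq0; apply/eqP.
  have -> : (p x^-1%g)^* = (p x)^* - p x^-1%g + p x by rewrite -e1; ring.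
  by ring.
by apply: mulfI; rewrite pnatr_eq0.
Qed.

(* Schur's product theorem. *)
Lemma positive_definiteM p q : positive_definite p -> positive_definite q ->
  positive_definite (fun x => p x * q x).
Proof.
move=> pp qp n c g.
pose P : 'M[C]_n := \matrix_(i, j) p ((g j)^-1 * g i)%g.
have Ph : P \is hermsymmx.
  apply/is_hermitianmxP; rewrite expr0 scale1r; apply/matrixP => i j.
  by rewrite !mxE -positive_definiteV// invgM invgK.
have /orthomx_spectralP := hermitian_normalmx Ph.
set S := spectralmx P; set d := spectral_diag P => PE.
have SU : S \is unitarymx := spectral_unitarymx P.
have Sunit := unitarymx_unit SU.
have PijE i j : P i j = \sum_k (S k i)^* * d 0 k * S k j.
  rewrite {1}PE invmx_unitary// mxE; apply: eq_bigr => k _.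
  rewrite mul_mx_diag mxE; congr (_ * _ * _).
  by rewrite !mxE.
have dE k : d 0 k = \sum_i \sum_j S k i * (S k j)^* * p ((g j)^-1 * g i)%g.
  have : S *m P *m map_mx Num.conj S^T = diag_mx d.
    by rewrite {1}PE -invmx_unitary// !mulmxA mulmxV// mul1mx mulmxK.
  move=> /matrixP/(_ k k); rewrite [RHS]mxE eqxx mulr1n => <-.
  rewrite mxE exchange_big /=; apply: eq_bigr => j _.
  rewrite mxE mulr_suml; apply: eq_bigr => i _.
  by rewrite !mxE; ring.
have d0 k : 0 <= d 0 k by rewrite dE; exact: pp.
have -> : \sum_(i < n) \sum_(j < n)
    c i * (c j)^* * (p ((g j)^-1 * g i)%g * q ((g j)^-1 * g i)%g) =
  \sum_k d 0 k * \sum_(i < n) \sum_(j < n)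
    (c i * (S k i)^*) * (c j * (S k j)^*)^* * q ((g j)^-1 * g i)%g.
  under [RHS]eq_bigr => k _.
    rewrite mulr_sumr; under eq_bigr => i _ do rewrite mulr_sumr; over.
  rewrite [RHS]exchange_big; apply: eq_bigr => i _.
  rewrite [RHS]exchange_big; apply: eq_bigr => j _.
  have -> : p ((g j)^-1 * g i)%g = P i j by rewrite mxE.
  rewrite PijE mulr_suml mulr_sumr; apply: eq_bigr => k _.
  by rewrite rmorphM /= conjCK; ring.
by apply: sumr_ge0 => k _; rewrite mulr_ge0//; exact: qp.
Qed.

End positive_definite.

(* A possibly non-unital subalgebra of the algebra of all functions T -> C
   under the pointwise operations. *)
Record function_algebra (C : fieldType) (T : Type) := FunctionAlgebra {
  falg_set :> set (T -> C);
  falg0 : falg_set (fun=> 0);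
  falgD : forall f g, falg_set f -> falg_set g ->
            falg_set (fun x => f x + g x);
  falgZ : forall a f, falg_set f -> falg_set (fun x => a * f x);
  falgM : forall f g, falg_set f -> falg_set g ->
            falg_set (fun x => f x * g x) }.

Section function_algebra_operations.
Variables (C : fieldType) (T : Type) (A : function_algebra C T).

Definition falg_add (f g : A) : A :=
  SigSub (mem_set (falgD (set_valP f) (set_valP g))).

Definition falg_scale (a : C) (f : A) : A :=
  SigSub (mem_set (falgZ a (set_valP f))).

Definition falg_mul (f g : A) : A :=
  SigSub (mem_set (falgM (set_valP f) (set_valP g))).

End function_algebra_operations.

Section character_space.
Variables (C : numFieldType) (T : Type).

Definition multiplicative_functionals (A : function_algebra C T) :
    set {ptws A -> C^o} :=
  [set chi | [/\ forall f g : A, chi (falg_add f g) = chi f + chi g,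
                 forall (a : C) (f : A), chi (falg_scale a f) = a * chi f,
                 forall f g : A, chi (falg_mul f g) = chi f * chi g &
                 exists f : A, chi f != 0]].

(* No continuity is required of the functionals: a multiplicative linear
   functional on a Banach algebra is automatically bounded.  The topology
   is induced by pointwise convergence on A, which on subsets of the dual of
   a Banach algebra is the weak* topology. *)
Definition character_space (A : function_algebra C T) : topologicalType :=
  set_type (@multiplicative_functionals A).

End character_space.

Section fourier_stieltjes.
Variables (R : realType) (G : groupType).
Local Notation C := R[i].

Definition fourier_stieltjes_set : set (G -> C) :=
  [set f | exists (n : nat) (c : 'I_n -> C) (p : 'I_n -> G -> C),
     (forall k, positive_definite (p k)) /\
     f = (fun x => \sum_(k < n) c k * p k x)].

(* c_0 of the discrete space G. *)
Definition c0_set : set (G -> C) :=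
  [set f | forall e : R, 0 < e -> finite_set [set x | (e%:C)%C <= `|f x|]].

Lemma fourier_stieltjes0 : fourier_stieltjes_set (fun=> 0).
Proof.
exists 0%N, (fun=> 0), (fun _ _ => 0); split => [[]//|].
by apply/funext => x; rewrite big_ord0.
Qed.

Lemma fourier_stieltjes_pd (p : G -> C) :
  positive_definite p -> fourier_stieltjes_set p.
Proof.
move=> pp; exists 1%N, (fun=> 1), (fun=> p); split => //.
by apply/funext => x; rewrite big_ord_recl big_ord0 mul1r addr0.
Qed.

Lemma fourier_stieltjesD (f g : G -> C) :
  fourier_stieltjes_set f -> fourier_stieltjes_set g ->
  fourier_stieltjes_set (fun x => f x + g x).
Proof.
move=> [n [c [p [pp ->]]]] [m [d [q [qq ->]]]].
exists (n + m)%N,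
  (fun k => match fintype.split k with inl i => c i | inr j => d j end),
  (fun k => match fintype.split k with inl i => p i | inr j => q j end); split.
  by move=> k; case: (fintype.split k).
apply/funext => x; rewrite big_split_ord /=; congr (_ + _);
  apply: eq_bigr => i _.
  by rewrite -[lshift m i]/(unsplit (inl i)) unsplitK.
by rewrite -[rshift n i]/(unsplit (inr i)) unsplitK.
Qed.

Lemma fourier_stieltjesZ (a : C) (f : G -> C) :
  fourier_stieltjes_set f -> fourier_stieltjes_set (fun x => a * f x).
Proof.
move=> [n [c [p [pp ->]]]]; exists n, (fun k => a * c k), p; split => //.
apply/funext => x; rewrite mulr_sumr.
by apply: eq_bigr => k _; rewrite mulrA.
Qed.

Lemma fourier_stieltjes_sum (n : nat) (f : 'I_n -> G -> C) :
  (forall k, fourier_stieltjes_set (f k)) ->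
  fourier_stieltjes_set (fun x => \sum_(k < n) f k x).
Proof.
elim: n f => [|n IH] f ff.
  rewrite (_ : (fun x => _) = fun=> 0); first exact: fourier_stieltjes0.
  by apply/funext => x; rewrite big_ord0.
rewrite (_ : (fun x => _) =
  fun x => f ord0 x + \sum_(k < n) f (lift ord0 k) x).
  by apply: fourier_stieltjesD => //; exact: IH.
by apply/funext => x; rewrite big_ord_recl.
Qed.

Lemma fourier_stieltjesM (f g : G -> C) :
  fourier_stieltjes_set f -> fourier_stieltjes_set g ->
  fourier_stieltjes_set (fun x => f x * g x).
Proof.
move=> [n [c [p [pp ->]]]] [m [d [q [qq ->]]]].
rewrite (_ : (fun x => _) = fun x =>
    \sum_(k < n) \sum_(l < m) (c k * d l) * (p k x * q l x)).
  apply: fourier_stieltjes_sum => k; apply: fourier_stieltjes_sum => l.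
  apply: fourier_stieltjesZ; apply: fourier_stieltjes_pd.
  exact: positive_definiteM.
apply/funext => x; rewrite mulr_suml; apply: eq_bigr => k _.
by rewrite mulr_sumr; apply: eq_bigr => l _; ring.
Qed.

Definition fourier_stieltjes : function_algebra C G :=
  FunctionAlgebra fourier_stieltjes0 fourier_stieltjesD fourier_stieltjesZ
                  fourier_stieltjesM.

Lemma c0_set0 : c0_set (fun=> 0).
Proof.
move=> e e0; rewrite (_ : [set _ | _] = set0)//.
by apply/seteqP; split => // x /=; rewrite normr0 lecR leNgt e0.
Qed.

Lemma realC_leNgt (e : R) (z : C) : ((e%:C)%C <= `|z|) = ~~ (`|z| < (e%:C)%C).
Proof.
rewrite real_leNgt// realE.
by case: (leP 0 e) => e0; rewrite !lecR ?e0 // (ltW e0) orbT.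
Qed.

Lemma c0_setD (f g : G -> C) :
  c0_set f -> c0_set g -> c0_set (fun x => f x + g x).
Proof.
move=> f0 g0 e e0; have e20 : 0 < e / 2 by rewrite divr_gt0.
have : finite_set ([set x | ((e / 2)%:C)%C <= `|f x|] `|`
                   [set x | ((e / 2)%:C)%C <= `|g x|]).
  by rewrite finite_setU; split; [exact: f0|exact: g0].
apply: sub_finite_set => x /=; rewrite !realC_leNgt => ex.
apply/orP; move: ex; apply: contraNT; rewrite negb_or !negbK => /andP[fx gx].
rewrite (le_lt_trans (ler_normD _ _))// (splitr e) rmorphD /=.
exact: ltrD.
Qed.

Lemma c0_setZ (a : C) (f : G -> C) : c0_set f -> c0_set (fun x => a * f x).
Proof.
have [->|a0] := eqVneq a 0.
  move=> _; rewrite (_ : (fun x => _) = fun=> 0); first exact: c0_set0.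
  by apply/funext => x; rewrite mul0r.
move=> f0 e e0.
have [M aM] : exists M : R, `|a| = (M%:C)%C.
  by exists (complex.Re `|a|); rewrite RRe_real.
have M0 : 0 < M by rewrite -ltcR -aM normr_gt0.
apply: sub_finite_set (f0 (e / M) (divr_gt0 e0 M0)) => x /=.
by rewrite normrM aM rmorphM /= fmorphV /= ler_pdivrMr ?ltcR// mulrC.
Qed.

Lemma c0_setM (f g : G -> C) :
  c0_set f -> c0_set g -> c0_set (fun x => f x * g x).
Proof.
move=> f0 g0 e e0.
have : finite_set ([set x | (1%:C)%C <= `|f x|] `|`
                   [set x | (e%:C)%C <= `|g x|]).
  by rewrite finite_setU; split; [exact: f0|exact: g0].
apply: sub_finite_set => x /=; rewrite !realC_leNgt => ex.
apply/orP; move: ex; apply: contraNT; rewrite negb_or !negbK => /andP[fx gx].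
by rewrite normrM -[ltRHS]mul1r ltr_pM.
Qed.

Definition fourier_stieltjes_c0_set : set (G -> C) :=
  fourier_stieltjes_set `&` c0_set.

Lemma fourier_stieltjes_c00 : fourier_stieltjes_c0_set (fun=> 0).
Proof. by split; [exact: fourier_stieltjes0|exact: c0_set0]. Qed.

Lemma fourier_stieltjes_c0D (f g : G -> C) :
  fourier_stieltjes_c0_set f -> fourier_stieltjes_c0_set g ->
  fourier_stieltjes_c0_set (fun x => f x + g x).
Proof.
by move=> [? ?] [? ?]; split; [exact: fourier_stieltjesD|exact: c0_setD].
Qed.

Lemma fourier_stieltjes_c0Z (a : C) (f : G -> C) : fourier_stieltjes_c0_set f ->
  fourier_stieltjes_c0_set (fun x => a * f x).
Proof.
by move=> [? ?]; split; [exact: fourier_stieltjesZ|exact: c0_setZ].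
Qed.

Lemma fourier_stieltjes_c0M (f g : G -> C) :
  fourier_stieltjes_c0_set f -> fourier_stieltjes_c0_set g ->
  fourier_stieltjes_c0_set (fun x => f x * g x).
Proof.
by move=> [? ?] [? ?]; split; [exact: fourier_stieltjesM|exact: c0_setM].
Qed.

Definition fourier_stieltjes_c0 : function_algebra C G :=
  FunctionAlgebra fourier_stieltjes_c00 fourier_stieltjes_c0D
    fourier_stieltjes_c0Z fourier_stieltjes_c0M.

End fourier_stieltjes.

Definition separable (T : topologicalType) : Prop :=
  exists D : set T, countable D /\ dense D.

(* Indexed by R, which has the cardinality of the continuum; disjointness
   together with nonemptiness makes the family injective. *)
Definition continuum_disjoint_open (R : realType) (T : topologicalType) : Prop :=
  exists U : R -> set T,
    [/\ forall t, open (U t), forall t, U t !=set0 & trivIset setT U].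

(* Main.v *)
(** Choose a dissociate sequence [x_k] in [H] and positive weights [a_k] tending
    to 0 so slowly that no power of them is square summable on an infinite union of
    the blocks [4^m <= k < 4^(m+1)].  For each set [S] of blocks the Riesz product with weights
    [a_k], [k] in [S], extended by 0 outside [H], is a positive definite [f_S] in
    [c_0] with [f_S(1) = 1] and [f_S <= 1/2] elsewhere; if [S] and [T] are almost
    disjoint, then [f_S f_T] has finite support.  Put [h_S = f_S - delta_1].

    There is a multiplicative functional with [|chi(h_S)| = 1].  Indeed, pairing
    with the trigonometric polynomials [prod (1 + i b (x_k + x_k^-1))] shows that
    the distance of [f_S^n] to the multiples of [delta_1] is bounded below
    uniformly in [n], so [g |-> lim_n dist(g f_S^n, C delta_1)] is a nonzero
    submultiplicative seminorm killing [delta_1], for which multiplication by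
    [f_S] is isometric.  A minimal such seminorm below it is multiplicative, and
    by the argument of Gelfand, Mazur and Ostrowski its quotient is the field of
    complex numbers.

    The sets [{chi : |chi(h_S)| > 1/2}] for a continuum of pairwise almost
    disjoint [S] are then disjoint: [h_S h_T] takes finitely many values, all of
    modulus at most 1/4, and a multiplicative functional maps it to 0 or to one
    of these values. *)

Require Import Defs.
From HB Require Import structures.
From mathcomp Require Import all_boot all_order all_algebra complex.
From mathcomp Require Import all_classical all_reals all_analysis.
From mathcomp Require Import ring lra zify.

Set Implicit Arguments.
Unset Strict Implicit.
Unset Printing Implicit Defensive.

Import Order.TTheory GRing.Theory Num.Theory.
Import numFieldNormedType.Exports.
Import Normc.

Local Open Scope classical_set_scope.
Local Open Scope ring_scope.

(** * Submultiplicative seminorms *)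

Section normc.
Variable R : realType.
Implicit Types x y : R[i].

Lemma norm_normc x : `|x| = ((normc x)%:C)%C.
Proof. by []. Qed.

Lemma normc_ge0 x : 0 <= normc x.
Proof. by rewrite -lecR -norm_normc normr_ge0. Qed.

Lemma normcD x y : normc (x + y) <= normc x + normc y.
Proof. by rewrite -lecR rmorphD /= -!norm_normc ler_normD. Qed.

Lemma normcR (r : R) : 0 <= r -> normc (r%:C)%C = r.
Proof. by move=> r0; apply: complexI; rewrite -norm_normc ger0_norm ?lecR. Qed.

End normc.

Section seminorms.
Variables (R : realType) (A : comNzRingType) (iota : {rmorphism R[i] -> A}).
Variable f : A.
Implicit Types (p q : A -> R) (E : A -> set R) (g h : A) (z : R[i]).

(** The condition [1 <= p 1] serves to exclude the zero seminorm; the equality [p 1 = 1] will come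
    out of minimality. *)
Record seminorm p : Prop := Seminorm {
  seminorm_ge0 : forall g, 0 <= p g;
  seminormD : forall g h, p (g + h) <= p g + p h;
  seminormM : forall g h, p (g * h) <= p g * p h;
  seminormZ : forall z g, p (iota z * g) <= normc z * p g;
  seminorm_inv : forall g, p (f * g) = p g;
  seminorm1 : 1 <= p 1 }.

(* [E g r] reads "the seminorm of [g] is at most [r]"; the seminorm itself is
   the infimum of [E g]. *)
Record gauge E : Prop := Gauge {
  gauge_nonempty : forall g, E g !=set0;
  gauge_ge0 : forall g r, E g r -> 0 <= r;
  gaugeD : forall g h r s, E g r -> E h s -> E (g + h) (r + s);
  gaugeM : forall g h r s, E g r -> E h s -> E (g * h) (r * s);
  gaugeZ : forall z g r, E g r -> E (iota z * g) (normc z * r);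
  gauge_inv : forall g r, E (f * g) r <-> E g r;
  gauge1 : exists2 d, 0 < d & forall r, E 1 r -> d <= r }.

(** New seminorms are produced as gauges, so that approximation of infima is carried out only here.
    Any positive lower bound [d] at 1 suffices: submultiplicativity gives [p 1 <= p 1 * p 1], which
    forces [1 <= p 1] once [p 1] is positive. *)
Lemma gauge_seminorm E : gauge E -> seminorm (fun g => inf (E g)).
Proof.
move=> [Ene Ege0 ED EM EZ Einv [d d0 Ed]].
have Ei g : has_inf (E g) by split => //; exists 0 => r; exact: Ege0.
have lei g r : E g r -> inf (E g) <= r.
  by move=> gr; apply: ge_inf => //; case: (Ei g).
have adh g e : 0 < e -> exists2 r, E g r & r < inf (E g) + e.
  by move=> e0; exact: inf_adherent.
have ge0 g : 0 <= inf (E g).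
  by apply: lb_le_inf; [exact: Ene|move=> r; exact: Ege0].
have M g h : inf (E (g * h)) <= inf (E g) * inf (E h).
  apply/ler_addgt0Pr => e e0.
  set a := inf (E g); set b := inf (E h).
  have ab1 : 0 < a + b + 1 by have := ge0 g; have := ge0 h; rewrite -/a -/b; lra.
  pose e' := Num.min 1 (e / (a + b + 1)).
  have e'0 : 0 < e' by rewrite lt_min ltr01 divr_gt0.
  have e'1 : e' <= 1 by rewrite ge_min lexx.
  have e'e : e' * (a + b + 1) <= e by rewrite -ler_pdivlMr// ge_min lexx orbT.
  have [r gr ra] := adh g _ e'0; have [s hs sb] := adh h _ e'0.
  apply: le_trans (lei _ _ (EM _ _ _ _ gr hs)) _.
  have r0 := Ege0 _ _ gr; have s0 := Ege0 _ _ hs.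
  apply: (@le_trans _ _ ((a + e') * (b + e'))).
    by rewrite ler_pM// ltW.
  have -> : (a + e') * (b + e') = a * b + e' * (a + b + e') by ring.
  rewrite lerD2l; apply: le_trans e'e; rewrite ler_pM2l//; lra.
split => //.
- move=> g h; apply/ler_addgt0Pr => e e0.
  have e20 : 0 < e / 2 by lra.
  have [r gr ra] := adh g _ e20; have [s hs sb] := adh h _ e20.
  by apply: le_trans (lei _ _ (ED _ _ _ _ gr hs)) _; lra.
- move=> z g; apply/ler_addgt0Pr => e e0.
  have z0 : 0 < normc z + 1 by have := normc_ge0 z; lra.
  have [r gr ra] := adh g _ (divr_gt0 e0 z0).
  apply: le_trans (lei _ _ (EZ z _ _ gr)) _.
  apply: (@le_trans _ _ (normc z * (inf (E g) + e / (normc z + 1)))).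
    by rewrite ler_wpM2l ?normc_ge0// ltW.
  rewrite mulrDr lerD2l mulrCA -[leRHS]mulr1 ler_wpM2l ?(ltW e0)//.
  by rewrite ler_pdivrMr//; lra.
- by move=> g; congr inf; apply/seteqP; split => r /Einv.
- have d1 : d <= inf (E 1) by apply: lb_le_inf; [exact: Ene|exact: Ed].
  have := M 1 1; rewrite mulr1 => m1.
  by rewrite -(ler_pM2l (lt_le_trans d0 d1)) mulr1.
Qed.

Definition minimal_seminorm p :=
  seminorm p /\ forall q, seminorm q -> (forall g, q g <= p g) -> p = q.

Lemma exists_minimal_seminorm p : seminorm p ->
  exists2 q, minimal_seminorm q & forall g, q g <= p g.
Proof.
move=> sp; pose T := {q : A -> R | seminorm q /\ forall g, q g <= p g}.
(* The order is reversed, so that a maximal element for Zorn's lemma is a minimal seminorm. *)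
pose le (s t : T) := `[< forall g, sval t g <= sval s g >].
have t0 : T by exists p; split => // g.
have [|u v w /asboolP uv /asboolP vw||m mmax] := @ZL_preorder T t0 le.
- by move=> u; apply/asboolP => g.
- by apply/asboolP => g; exact: le_trans (vw g) (uv g).
- move=> B Btot.
  have [[b Bb]|B0] := pselect (B !=set0); last first.
    by exists t0 => s Bs; exfalso; apply: B0; exists s.
  (* The infimum over the chain. Two members of the chain are comparable, so the smaller one bounds
     both [g] and [h], which gives the sum and product rules. *)
  pose E g := [set r : R | exists2 t : T, B t & sval t g <= r].
  have gE : gauge E.
    split.
    - by move=> g; exists (sval b g), b.
    - by move=> g r [t _]; apply: le_trans; exact: seminorm_ge0 (proj1 (svalP t)) _.
    - move=> g h r s [t Bt tg] [u Bu uh].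
      have [|] := Btot t u Bt Bu => /asboolP tu.
        exists u => //; apply: le_trans (seminormD (proj1 (svalP u)) _ _) _.
        by apply: lerD => //; exact: le_trans (tu g) tg.
      exists t => //; apply: le_trans (seminormD (proj1 (svalP t)) _ _) _.
      by apply: lerD => //; exact: le_trans (tu h) uh.
    - move=> g h r s [t Bt tg] [u Bu uh].
      have [|] := Btot t u Bt Bu => /asboolP tu.
        exists u => //; apply: le_trans (seminormM (proj1 (svalP u)) _ _) _.
        apply: ler_pM; rewrite ?(seminorm_ge0 (proj1 (svalP u)))//.
        exact: le_trans (tu g) tg.
      exists t => //; apply: le_trans (seminormM (proj1 (svalP t)) _ _) _.
      apply: ler_pM; rewrite ?(seminorm_ge0 (proj1 (svalP t)))//.
      exact: le_trans (tu h) uh.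
    - move=> z g r [t Bt tg]; exists t => //.
      apply: le_trans (seminormZ (proj1 (svalP t)) _ _) _.
      by rewrite ler_wpM2l ?normc_ge0.
    - by move=> g r; split => -[t Bt]; exists t => //;
        rewrite ?(seminorm_inv (proj1 (svalP t)))// -(seminorm_inv (proj1 (svalP t))).
    - exists 1 => // r [t _]; apply: le_trans.
      exact: seminorm1 (proj1 (svalP t)).
  have lei g r : E g r -> inf (E g) <= r.
    by apply: ge_inf; exists 0 => s; exact: gauge_ge0 gE _ _.
  have qT : seminorm (fun g => inf (E g)) /\ forall g, inf (E g) <= p g.
    split; first exact: gauge_seminorm.
    by move=> g; apply: lei; exists b => //; exact: (proj2 (svalP b)).
  exists (exist (fun q => seminorm q /\ forall g, q g <= p g) _ qT) => s Bs.
  apply/asboolP => g /=.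
  by apply: lei; exists s.
exists (sval m); last exact: (proj2 (svalP m)).
split; first exact: (proj1 (svalP m)).
move=> q sq qm.
have qT : seminorm q /\ forall g, q g <= p g.
  by split => // g; apply: le_trans (qm g) (proj2 (svalP m) g).
apply/funext => g; apply/eqP; rewrite eq_le qm andbT.
suff /asboolP : le (exist (fun q => seminorm q /\ forall g, q g <= p g) q qT) m by apply.
by apply: mmax; apply/asboolP.
Qed.

End seminorms.

Lemma normcX (R : realType) (z : R[i]) n : normc (z ^+ n) = normc z ^+ n.
Proof. by apply: complexI; rewrite -norm_normc normrX rmorphXn. Qed.

(** * Minimal seminorms are multiplicative *)

Section multiplicativity.
Variables (R : realType) (A : comNzRingType) (iota : {rmorphism R[i] -> A}).
Variable f : A.
Implicit Types (p q : A -> R) (E : A -> set R) (g h : A) (z : R[i]).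

Section seminorm.
Variable p : A -> R.
Hypothesis sp : seminorm iota f p.

Let p0 := seminorm_ge0 sp.

Lemma seminorm0 : p 0 = 0.
Proof.
apply/eqP; rewrite eq_le p0 andbT.
by have := seminormZ sp 0 0; rewrite normc0 mulr0 mul0r.
Qed.

Lemma seminorm_mulrn g n : p (g *+ n) <= p g *+ n.
Proof.
elim: n => [|n IH]; first by rewrite mulr0n seminorm0.
by rewrite !mulrS (le_trans (seminormD sp _ _))// lerD2l.
Qed.

Lemma seminorm_sum n (u : 'I_n -> A) : p (\sum_(i < n) u i) <= \sum_(i < n) p (u i).
Proof.
elim: n u => [|n IH] u; first by rewrite !big_ord0 seminorm0.
by rewrite !big_ord_recl (le_trans (seminormD sp _ _))// lerD2l.
Qed.

Lemma seminormX_le g n : p (g ^+ n) <= p 1 * p g ^+ n.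
Proof.
elim: n => [|n IH]; first by rewrite !expr0 mulr1.
rewrite !exprS (le_trans (seminormM sp _ _))// mulrCA.
by rewrite ler_wpM2l.
Qed.

Lemma seminorm_invX g n : p (f ^+ n * g) = p g.
Proof.
by elim: n => [|n IH]; rewrite ?expr0 ?mul1r// exprS -mulrA (seminorm_inv sp).
Qed.

End seminorm.

Section minimal.
Variable p : A -> R.
Hypothesis mp : minimal_seminorm iota f p.
Let sp : seminorm iota f p := proj1 mp.
Let p0 := seminorm_ge0 sp.

(** The only direct use of minimality: the seminorm of a gauge lying below [p] must be [p] itself,
    so every value of the gauge bounds [p] from above. *)
Lemma minimal_le_gauge E : gauge iota f E -> (forall g, E g (p g)) ->
  forall g r, E g r -> p g <= r.
Proof.
move=> gE Ep g r gr.
have lei h s : E h s -> inf (E h) <= s.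
  by apply: ge_inf; exists 0 => t; exact: gauge_ge0 gE _ _.
have -> : p = fun h => inf (E h).
  by apply: (proj2 mp); [exact: gauge_seminorm|move=> h; exact: lei].
exact: lei.
Qed.

(** The admissible growth rates of [p (h ^+ i)] form a gauge whose infimum is the spectral radius.
    Commutativity enters through the binomial formula, which shows that rates add. By minimality [p]
    is its own spectral radius. *)
Lemma minimal_le_spectral g K r : 0 <= r ->
  (forall i, p (g ^+ i) <= K * r ^+ i) -> p g <= r.
Proof.
pose E h := [set s : R | 0 <= s /\ exists K, forall i, p (h ^+ i) <= K * s ^+ i].
move=> r0 gr; apply: (@minimal_le_gauge E) => [|h|]; last 2 first.
- by split; [exact: p0|exists (p 1) => i; exact: seminormX_le].
- by split => //; exists K.
clear g r K r0 gr.
split.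
- by move=> g; exists (p g); split; [|exists (p 1) => i; exact: seminormX_le].
- by move=> g r [].
- move=> g h r s [r0 [K Kg]] [s0 [L Lh]]; split; first exact: addr_ge0.
  exists (K * L) => n; rewrite !exprDn mulr_sumr.
  apply: le_trans (seminorm_sum sp _) _; apply: ler_sum => i _.
  apply: le_trans (seminorm_mulrn sp _ _) _.
  rewrite mulrnAr lerMn2r; apply/orP; right.
  apply: le_trans (seminormM sp _ _) _.
  by rewrite mulrACA ler_pM.
- move=> g h r s [r0 [K Kg]] [s0 [L Lh]]; split; first exact: mulr_ge0.
  exists (K * L) => n; rewrite !exprMn.
  apply: le_trans (seminormM sp _ _) _.
  by rewrite mulrACA ler_pM.
- move=> z g r [r0 [K Kg]]; split; first by rewrite mulr_ge0 ?normc_ge0.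
  exists K => n; rewrite !exprMn -rmorphXn mulrCA -normcX.
  by apply: le_trans (seminormZ sp _ _) _; rewrite ler_wpM2l ?normc_ge0.
- move=> g r; split => -[r0 [K Kg]]; split => //; exists K => i.
    by rewrite -(seminorm_invX sp _ i) -exprMn.
  by rewrite exprMn (seminorm_invX sp).
(* A rate [r < 1/2] for the unit would give [1 <= p 1 <= K * r ^+ i] for all [i], which fails as
   soon as [K < 2 ^+ i]. *)
- exists 2^-1; first by rewrite invr_gt0.
  move=> r [r0 [K Kr]]; rewrite leNgt; apply/negP => r2.
  have := upper_nthrootP (leqnn (Num.bound K)).
  set i := Num.bound K => Ki.
  have := Kr i; rewrite expr1n => Kri.
  have : 1 < 1 :> R; last by rewrite ltxx.
  apply: le_lt_trans (le_trans (seminorm1 sp) Kri) _.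
  have [K0|K0] := leP K 0.
    by apply: le_lt_trans ltr01; rewrite mulr_le0_ge0// exprn_ge0.
  apply: (@le_lt_trans _ _ (K * 2^-1 ^+ i)).
    by rewrite ler_pM2l// lerXn2r ?nnegrE ?invr_ge0// ltW.
  by rewrite exprVn ltr_pdivrMr ?exprn_gt0// mul1r.
Qed.

Lemma minimal_seminorm1 : p 1 = 1.
Proof.
apply/eqP; rewrite eq_le (seminorm1 sp) andbT.
by apply: (@minimal_le_spectral _ (p 1)) => // i; rewrite !expr1n mulr1.
Qed.

(** If [p (g ^+ 2) < p g ^+ 2], the square root of a number [m] strictly between them is a growth
    rate of the powers of [g], even and odd ones alike, and it is smaller than [p g]. *)
Lemma minimal_sqr g : p g ^+ 2 <= p (g ^+ 2).
Proof.
rewrite leNgt; apply/negP => lt2.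
pose m := (p (g ^+ 2) + p g ^+ 2) / 2.
have g2 : p (g ^+ 2) < m by rewrite /m; lra.
have m2 : m < p g ^+ 2 by rewrite /m; lra.
have m0 : 0 < m by apply: le_lt_trans g2.
pose r := Num.sqrt m.
have r0 : 0 < r by rewrite sqrtr_gt0.
have rm : r ^+ 2 = m by rewrite sqr_sqrtr// ltW.
suff : p g <= r.
  move=> gr; have : p g ^+ 2 <= r ^+ 2 by apply: lerXn2r; rewrite // nnegrE// ltW.
  by rewrite rm; lra.
apply: (@minimal_le_spectral _ (1 + p g / r)) => [|i]; first exact: ltW.
have gr0 : 0 <= p g / r by rewrite divr_ge0// ltW.
have odd1 : p (g ^+ odd i) <= (1 + p g / r) * r ^+ odd i.
  case: (odd i); last by rewrite !expr0 mulr1 minimal_seminorm1 lerDl.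
  by rewrite !expr1 mulrDl mul1r mulfVK ?gt_eqF// lerDr ltW.
rewrite -{1 2}(odd_double_half i) -mul2n. rewrite !(exprD _ (odd i)) !exprM mulrA.
apply: le_trans (seminormM sp _ _) _; apply: ler_pM => //.
apply: le_trans (seminormX_le sp _ _) _.
by rewrite minimal_seminorm1 mul1r rm; apply: lerXn2r; rewrite ?nnegrE ?p0// ltW.
Qed.

(** Squaring repeatedly settles the exponents [2 ^ k]. For a general [n], the equality at [2 ^ n] is
    compared with the bound for the product of [g ^+ (2 ^ n - n)] and [g ^+ n], and the positive
    factor is cancelled. *)
Lemma minimalX g n : p g ^+ n = p (g ^+ n).
Proof.
apply/eqP; rewrite eq_le; apply/andP; split; last first.
  by apply: le_trans (seminormX_le sp _ _) _; rewrite minimal_seminorm1 mul1r.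
have X2 k : p g ^+ (2 ^ k) <= p (g ^+ (2 ^ k)).
  elim: k => [|k IH]; first by rewrite !expr1.
  rewrite expnSr !exprM; apply: le_trans (minimal_sqr _).
  by rewrite lerXn2r ?nnegrE// exprn_ge0.
have [g0|g0] := leP (p g) 0.
  case: n => [|n]; first by rewrite !expr0 minimal_seminorm1.
  have -> : p g = 0 by apply/eqP; rewrite eq_le g0 p0.
  by rewrite expr0n.
have nn : (n <= 2 ^ n)%N by rewrite ltnW// ltn_expl.
have := X2 n; rewrite -{1 2}(subnK nn) !exprD => le2.
rewrite -(ler_pM2l (exprn_gt0 (2 ^ n - n) g0)); apply: le_trans le2 _.
apply: le_trans (seminormM sp _ _) _; rewrite ler_wpM2r//.
by apply: le_trans (seminormX_le sp _ _) _; rewrite minimal_seminorm1 mul1r.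
Qed.

(** The quotients [p (k * h ^+ n) / p h ^+ n] do not increase with [n], and their infimum over [n]
    is a seminorm of [k] below [p], hence equal to [p]. The term [n = 1] at [k = g] gives the
    missing inequality. *)
Lemma minimalM g h : p (g * h) = p g * p h.
Proof.
apply/eqP; rewrite eq_le (seminormM sp)/=.
have [h0|h0] := leP (p h) 0.
  have -> : p h = 0 by apply/eqP; rewrite eq_le h0 p0.
  by rewrite mulr0.
rewrite -ler_pdivlMr//.
pose E k := [set r : R | exists n, p (k * h ^+ n) <= r * p h ^+ n].
have hn n : 0 < p h ^+ n by rewrite exprn_gt0.
have Em k m n r : p (k * h ^+ n) <= r * p h ^+ n ->
    p (k * h ^+ (m + n)) <= r * p h ^+ (m + n).
  move=> kr; rewrite !exprD mulrCA (le_trans (seminormM sp _ _))//.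
  by rewrite -minimalX mulrCA ler_pM2l.
apply: (@minimal_le_gauge E) => [|k|]; last 2 first.
- by exists 0%N; rewrite !expr0 !mulr1.
- by exists 1%N; rewrite !expr1 divfK ?gt_eqF.
split.
- by move=> k; exists (p k), 0%N; rewrite !expr0 !mulr1.
- move=> k r [n knr]; rewrite -(pmulr_lge0 _ (hn n)).
  exact: le_trans (p0 _) knr.
- move=> k l r s [n kn] [m lm]; exists (m + n)%N.
  rewrite !mulrDl; apply: le_trans (seminormD sp _ _) _; apply: lerD.
    exact: Em.
  by rewrite addnC; exact: Em.
- move=> k l r s [n kn] [m lm]; exists (n + m)%N.
  rewrite !exprD mulrACA [leRHS]mulrACA (le_trans (seminormM sp _ _))//.
  by rewrite ler_pM.
- move=> z k r [n kn]; exists n; rewrite -!mulrA.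
  by apply: le_trans (seminormZ sp _ _) _; rewrite ler_wpM2l ?normc_ge0.
- by move=> k r; split => -[n kn]; exists n; move: kn;
    rewrite -mulrA (seminorm_inv sp).
- by exists 1 => // r [n]; rewrite mul1r -minimalX ler_pMl.
Qed.

End minimal.
End multiplicativity.

(** * Existence of characters *)

Section gelfand_mazur.
Variables (R : realType) (A : comNzRingType) (iota : {rmorphism R[i] -> A}).
Variables (f : A) (p : A -> R).
Hypothesis mp : minimal_seminorm iota f p.
Let sp : seminorm iota f p := proj1 mp.
Let p0 := seminorm_ge0 sp.
Implicit Types (a b : A) (z w c : R[i]).

Lemma minimal_iota z : p (iota z) = normc z.
Proof.
have le w : p (iota w) <= normc w.
  by rewrite -[iota w]mulr1 (le_trans (seminormZ sp _ _))// (minimal_seminorm1 mp) mulr1.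
have [->|z0] := eqVneq z 0; first by rewrite rmorph0 (seminorm0 sp) normc0.
have nz0 : 0 < normc z.
  by rewrite lt_neqAle normc_ge0 andbT eq_sym; apply: contra z0 => /eqP/eq0_normc ->.
apply/eqP; rewrite eq_le le/= -(ler_pM2r (x := (normc z)^-1)) ?invr_gt0//.
rewrite mulfV ?gt_eqF// -(minimal_seminorm1 mp) -(rmorph1 iota) -(mulfV z0).
by rewrite rmorphM (le_trans (seminormM sp _ _))// -normcV ler_wpM2l.
Qed.

Lemma minimalB a b : p a <= p (a - b) + p b.
Proof. by rewrite -{1}(subrK b a) (seminormD sp). Qed.

Lemma minimalN a : p (- a) = p a.
Proof.
rewrite -mulN1r -(rmorph1 iota) -rmorphN (minimalM mp) minimal_iota.
by rewrite normcN normc1 mul1r.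
Qed.

Lemma minimal_lip a z w : p (a - iota z) <= p (a - iota w) + normc (w - z).
Proof.
rewrite -minimal_iota rmorphB (le_trans _ (seminormD sp _ _))//.
by rewrite addrA subrK.
Qed.

(* [b ^+ n - iota c ^+ n] splits into [b - iota c] and [n.-1] further linear
   factors, each of seminorm at least [p b]. *)
Lemma minimal_step b c : (forall z, p b <= p (b - iota z)) -> 0 < p b ->
  normc c <= p b / 2 -> p (b - iota c) <= p b.
Proof.
move=> bmin b0 cb; apply/ler_addgt0Pr => e e0.
(* This [n] makes [normc c ^+ n.+1] at most [e * p b ^+ n], hence [p (b ^+ n.+1 - iota (c ^+ n.+1))]
   at most [(p b + e) * p b ^+ n]. *)
pose n := Num.bound (p b / e).
have ne : p b / 2 ^+ n.+1 <= e.
  rewrite ler_pdivrMr ?exprn_gt0// mulrC -ler_pdivrMr//.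
  by rewrite ltW// upper_nthrootP.
suff : p (b - iota c) * p b ^+ n <= (p b + e) * p b ^+ n.
  by rewrite ler_pM2r// exprn_gt0.
apply: (@le_trans _ _ (p (b ^+ n.+1 - iota (c ^+ n.+1)))); last first.
  apply: le_trans (seminormD sp _ _) _; rewrite minimalN minimal_iota.
  rewrite -(minimalX mp) mulrDl -exprS lerD2l normcX.
  apply: (@le_trans _ _ ((p b / 2) ^+ n.+1)).
    by apply: lerXn2r; rewrite // nnegrE ?normc_ge0// divr_ge0// p0.
  by rewrite expr_div_n exprSr -mulrA mulrC ler_wpM2r ?exprn_ge0.
pose P : {poly R[i]} := 'X^(n.+1) - (c ^+ n.+1)%:P.
have [r Pr] := closed_field_poly_normal P.
have lP : lead_coef P = 1 by apply/monicP; exact: monicXnsubC.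
rewrite lP scale1r in Pr.
have sr : size r = n.+1.
  by have := size_XnsubC (c ^+ n.+1) (ltn0Sn n); rewrite -/P Pr size_prod_XsubC => -[].
have cr : c \in r.
  by rewrite -root_prod_XsubC -Pr /root !hornerE subrr.
have -> : b ^+ n.+1 - iota (c ^+ n.+1) = \prod_(z <- r) (b - iota z).
  transitivity (map_poly iota P).[b].
    by rewrite /P rmorphB /= map_polyXn map_polyC/= !hornerE.
  rewrite Pr rmorph_prod horner_prod; apply: eq_bigr => z _.
  by rewrite /= rmorphB /= map_polyX map_polyC/= !hornerE.
rewrite (big_rem c cr)/= (minimalM mp) ler_wpM2l//.
have -> : n = size (rem c r) by rewrite size_rem// sr.
elim: (rem c r) => [|z s IH]; first by rewrite big_nil expr0 (minimal_seminorm1 mp).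
by rewrite big_cons (minimalM mp) /= exprS ler_pM// exprn_ge0.
Qed.

(** The function is Lipschitz in [z], and where [normc z > 2 * p a] it is at least its value [p a]
    at 0, so a minimum over a compact square is global. *)
Lemma exists_min_seminorm a : exists z, forall w, p (a - iota z) <= p (a - iota w).
Proof.
pose toC (u : R * R) : R[i] := (u.1 +i* u.2)%C.
pose F (u : R * R) := p (a - iota (toC u)).
have nl (x y : R) : normc (x +i* y)%C <= `|x| + `|y|.
  have -> : (x +i* y)%C = (x%:C)%C + (0 +i* y)%C by simpc.
  apply: le_trans (normcD _ _) _.
  by rewrite /= !expr0n /= addr0 add0r !sqrtr_sqr.
have lip u v : F u <= F v + (`|v.1 - u.1| + `|v.2 - u.2|).
  by apply: le_trans (minimal_lip a _ (toC v)) _; rewrite lerD2l nl.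
pose M := 2 * p a.
have M0 : 0 <= M by rewrite mulr_ge0.
have cF : continuous F.
  move=> u; apply/cvgrPdist_lt => e e0.
  have e20 : 0 < e / 2 by rewrite divr_gt0.
  have /cvgrPdist_lt/(_ _ e20) c1 : fst x @[x --> u] --> u.1 by exact: cvg_fst.
  have /cvgrPdist_lt/(_ _ e20) c2 : snd x @[x --> u] --> u.2 by exact: cvg_snd.
  near=> v.
  have v1 : `|u.1 - v.1| < e / 2 by near: v.
  have v2 : `|u.2 - v.2| < e / 2 by near: v.
  have := lip u v; have := lip v u.
  rewrite (distrC v.1) (distrC v.2) ltr_norml; lra.
have cK : compact (`[-M, M] `*` `[-M, M] : set (R * R)).
  by apply: compact_setX; exact: segment_compact.
have [|c cM cmin] := compact_EVT_min _ cK (continuous_subspaceT cF).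
  by exists (0, 0); split => /=; rewrite in_itv/= oppr_le0 M0.
exists (toC c) => w.
have [wM|wM] := leP (normc w) M.
  have := cmin (complex.Re w, complex.Im w).
  rewrite /F /toC /=; case: w wM => x y wM /=; apply.
  have h (t s : R) : `|t| <= Num.sqrt (t ^+ 2 + s ^+ 2).
    by rewrite -sqrtr_sqr ler_wsqrtr// lerDl sqr_ge0.
  rewrite inE; split; rewrite /= in_itv /= -ler_norml; apply: le_trans wM.
    exact: h.
  by rewrite /= addrC; exact: h.
apply: (@le_trans _ _ (p a)).
  have := cmin (0, 0); rewrite /F.
  have -> : toC (0, 0) = 0 by [].
  rewrite rmorph0 subr0; apply.
  by rewrite inE; split => /=; rewrite in_itv/= oppr_le0 M0.
have := minimalB (iota w) a; rewrite minimal_iota -opprB minimalN.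
by move: wM; rewrite /M; lra.
Unshelve. all: by end_near.
Qed.

(** If the minimal distance [m] were positive, [minimal_step] would show that moving a minimizer by
    [m / 2] gives another minimizer. The minimizers would then be unbounded, although each is within
    [m] of [a]. *)
Lemma gelfand_mazur a : exists z, p (a - iota z) = 0.
Proof.
have [z0 zmin] := exists_min_seminorm a; exists z0.
apply/eqP; rewrite eq_le p0 andbT leNgt; apply/negP => m0.
set m := p (a - iota z0) in zmin m0.
have m2 : 0 <= m / 2 by rewrite divr_ge0// ltW.
have step k : p (a - iota (z0 + ((k%:R * (m / 2))%:C)%C)) = m.
  elim: k => [|k IH]; first by rewrite mul0r addr0.
  apply/eqP; rewrite eq_le zmin andbT.
  have -> : ((k.+1%:R * (m / 2))%:C)%C = ((k%:R * (m / 2))%:C)%C + ((m / 2)%:C)%C.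
    by rewrite -rmorphD /=; congr (_%:C)%C; rewrite -addn1 natrD; ring.
  rewrite addrA rmorphD opprD addrA.
  rewrite -[leRHS]IH; apply: minimal_step; rewrite ?IH// ?normcR//.
  by move=> z; rewrite -addrA -opprD -rmorphD.
(* Six steps reach distance [3 * m], whereas two minimizers differ by at most [2 * m]. *)
have s6 := step 6%N; set c := ((6%:R * (m / 2))%:C)%C in s6.
have := minimalB (iota c) (a - iota z0).
have -> : iota c - (a - iota z0) = - (a - iota (z0 + c)).
  by rewrite rmorphD; ring.
rewrite minimalN s6 minimal_iota normcR; last by rewrite mulr_ge0.
by rewrite -/m; lra.
Qed.

End gelfand_mazur.

(** For a minimal [p] below the gauge, [phi a] is the unique [z] with [p (a - iota z) = 0]; then
    [normc (phi a) = p a], and isometry of multiplication by [f] yields [normc (phi f) = 1]. *)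
Theorem gauge_character (R : realType) (A : comNzRingType)
    (iota : {rmorphism R[i] -> A}) (f : A) (E : A -> set R) : gauge iota f E ->
  exists phi : A -> R[i],
    [/\ forall a b, phi (a + b) = phi a + phi b,
        forall a b, phi (a * b) = phi a * phi b,
        forall z, phi (iota z) = z,
        forall a r, E a r -> normc (phi a) <= r &
        normc (phi f) = 1].
Proof.
move=> gE; have [p mp pE] := exists_minimal_seminorm (gauge_seminorm gE).
have sp := proj1 mp; have p0 := seminorm_ge0 sp.
have [phi phiP] := choice (gelfand_mazur mp).
have phi_uniq a z : p (a - iota z) <= 0 -> phi a = z.
  move=> az; apply/eqP; rewrite -subr_eq0; apply/eqP/eq0_normc/eqP.
  rewrite eq_le normc_ge0 andbT -(minimal_iota mp) rmorphB.
  have -> : iota (phi a) - iota z = (a - iota z) - (a - iota (phi a)) by ring.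
  by apply: le_trans (seminormD sp _ _) _; rewrite (minimalN mp) phiP addr0.
have phi_norm a : normc (phi a) = p a.
  rewrite -(minimal_iota mp); apply/eqP; rewrite eq_le.
  have := minimalB mp (iota (phi a)) a; have := minimalB mp a (iota (phi a)).
  by rewrite -[iota _ - a]opprB (minimalN mp) phiP !add0r => -> ->.
exists phi; split.
- move=> a b; apply: phi_uniq; rewrite rmorphD.
  have -> : a + b - (iota (phi a) + iota (phi b)) =
            (a - iota (phi a)) + (b - iota (phi b)) by ring.
  by apply: le_trans (seminormD sp _ _) _; rewrite !phiP addr0.
- move=> a b; apply: phi_uniq; rewrite rmorphM.
  have -> : a * b - iota (phi a) * iota (phi b) =
            (a - iota (phi a)) * b + iota (phi a) * (b - iota (phi b)) by ring.
  apply: le_trans (seminormD sp _ _) _.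
  by rewrite !(minimalM mp) !phiP mul0r mulr0 addr0.
- by move=> z; apply: phi_uniq; rewrite subrr (seminorm0 sp).
- move=> a r ar; rewrite phi_norm (le_trans (pE _))//.
  by apply: ge_inf => //; exists 0 => s; exact: gauge_ge0 gE _ _.
- by rewrite phi_norm -[f]mulr1 (seminorm_inv sp) (minimal_seminorm1 mp).
Qed.

(** * Positive definite functions and the norm of B(G) *)

Section positive_definite_functions.
Variables (C : numClosedFieldType) (G : groupType).
Implicit Types p q : G -> C.

Lemma positive_definiteD p q : positive_definite p -> positive_definite q ->
  positive_definite (fun x => p x + q x).
Proof.
move=> pp qp n c g; rewrite (eq_bigr (fun i =>
    \sum_(j < n) c i * (c j)^* * p ((g j)^-1 * g i)%g +
    \sum_(j < n) c i * (c j)^* * q ((g j)^-1 * g i)%g)).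
  by rewrite big_split addr_ge0 ?pp ?qp.
by move=> i _; rewrite -big_split; apply: eq_bigr => j _; rewrite mulrDr.
Qed.

Lemma positive_definiteZ (a : C) p : 0 <= a -> positive_definite p ->
  positive_definite (fun x => a * p x).
Proof.
move=> a0 pp n c g; rewrite (eq_bigr (fun i =>
    a * \sum_(j < n) c i * (c j)^* * p ((g j)^-1 * g i)%g)).
  by rewrite -mulr_sumr mulr_ge0// pp.
by move=> i _; rewrite mulr_sumr; apply: eq_bigr => j _; rewrite mulrCA.
Qed.

Lemma positive_definite_cst1 : positive_definite (fun _ : G => 1 : C).
Proof.
move=> n c g; under eq_bigr do under eq_bigr do rewrite mulr1.
rewrite -[X in 0 <= X](_ : (\sum_i c i) * (\sum_i c i)^* = _) ?mul_conjC_ge0//.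
rewrite rmorph_sum mulr_suml; apply: eq_bigr => i _.
by rewrite mulr_sumr.
Qed.

Lemma positive_definiteX p n : positive_definite p ->
  positive_definite (fun x => p x ^+ n).
Proof.
move=> pp; elim: n => [|n IH]; first exact: positive_definite_cst1.
rewrite (_ : (fun x => _) = fun x => p x * p x ^+ n).
  exact: positive_definiteM.
by apply/funext => x; rewrite exprS.
Qed.

(** Each instance of positivity involves finitely many values of [p]. This transfers positivity from
    the partial Riesz products to the infinite one. *)
Lemma positive_definite_approx p :
  (forall s : seq G, exists2 q, positive_definite q & {in s, p =1 q}) ->
  positive_definite p.
Proof.
move=> pq n c g.
have [q qp eq_pq] := pq [seq ((g u.2)^-1 * g u.1)%g | u : 'I_n * 'I_n].
rewrite (eq_bigr (fun i => \sum_(j < n) c i * (c j)^* * q ((g j)^-1 * g i)%g)).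
  exact: qp.
move=> i _; apply: eq_bigr => j _; congr (_ * _); apply: eq_pq.
by apply/mapP; exists (i, j); rewrite ?mem_enum.
Qed.

(** Grouping the entries by their second component turns the form into a sum of squared moduli. *)
Lemma equality_kernel_ge0 (T : eqType) (s : seq (C * T)) :
  0 <= \sum_(u <- s) \sum_(v <- s) u.1 * v.1^* * (u.2 == v.2)%:R.
Proof.
pose Z := undup (map snd s).
have -> : \sum_(u <- s) \sum_(v <- s) u.1 * v.1^* * (u.2 == v.2)%:R =
    \sum_(z <- Z) (\sum_(u <- s) u.1 * (u.2 == z)%:R) *
                  (\sum_(u <- s) u.1 * (u.2 == z)%:R)^*.
  transitivity (\sum_(u <- s) \sum_(v <- s) \sum_(z <- Z)
      u.1 * (u.2 == z)%:R * (v.1 * (v.2 == z)%:R)^*).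
    rewrite [LHS]big_seq [RHS]big_seq; apply: eq_bigr => u us.
    apply: eq_bigr => v _.
    rewrite (big_rem u.2)/=; last by rewrite mem_undup map_f.
    rewrite big1_seq ?addr0; last first.
      move=> z /andP[_]; rewrite mem_rem_uniq ?undup_uniq// => /andP[/= zu _].
      by rewrite eq_sym (negbTE zu) mulr0 mul0r.
    by rewrite eqxx mulr1 rmorphM /= conjC_nat mulrA (eq_sym v.2).
  under eq_bigr do rewrite exchange_big /=.
  rewrite exchange_big /=; apply: eq_bigr => z _.
  rewrite rmorph_sum mulr_suml; apply: eq_bigr => u _.
  by rewrite mulr_sumr.
by apply: sumr_ge0 => z _; exact: mul_conjC_ge0.
Qed.

(** The convolution of [\sum_(u <- s) delta_u] with its adjoint, with repetitions in [s] counted. *)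
Definition autocorrelation (s : seq G) (x : G) : C :=
  \sum_(u <- s) \sum_(v <- s) (x == u * v^-1)%g%:R.

Lemma positive_definite_autocorrelation s :
  positive_definite (autocorrelation s).
Proof.
move=> n c g.
pose S := [seq (c w.1, (g w.1 * w.2)%g) | w <- [seq (i, u) | i <- enum 'I_n, u <- s]].
have sumS (h : C * G -> C) :
    \sum_(w <- S) h w = \sum_(i < n) \sum_(u <- s) h (c i, (g i * u)%g).
  by rewrite big_map big_allpairs_dep /= big_enum.
have := equality_kernel_ge0 S; rewrite sumS; congr (0 <= _).
apply: eq_bigr => i _.
under eq_bigr do rewrite sumS.
rewrite exchange_big /=; apply: eq_bigr => j _.
rewrite /autocorrelation mulr_sumr exchange_big /=; apply: eq_bigr => u _.
rewrite mulr_sumr; apply: eq_bigr => v _; congr (_ * (nat_of_bool _)%:R).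
apply/eqP/eqP => [e|e].
  have -> : (g i = g j * u * v^-1)%g by rewrite -e mulgK.
  by rewrite !mulgA mulVg mul1g.
have -> : (g i = g j * (u * v^-1))%g by rewrite -e mulgA mulgV mul1g.
by rewrite !mulgA mulgVK.
Qed.

(** A cone of positive definite functions generated by elements of [H]. A Riesz factor acts
    linearly, so its effect on the cone need only be checked on autocorrelations, where commutation
    inside [H] is available. *)
Inductive autocorrelation_cone (H : set G) : (G -> C) -> Prop :=
| autocorrelation_cone_seq s : (forall x, x \in s -> H x) ->
    autocorrelation_cone H (autocorrelation s)
| autocorrelation_coneD p q : autocorrelation_cone H p ->
    autocorrelation_cone H q -> autocorrelation_cone H (fun x => p x + q x)
| autocorrelation_coneZ a p : 0 <= a -> autocorrelation_cone H p ->
    autocorrelation_cone H (fun x => a * p x).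

Lemma autocorrelation_cone_pd H p :
  autocorrelation_cone H p -> positive_definite p.
Proof.
elim=> [s _|q r _ pq _ pr|a q a0 _ pq].
- exact: positive_definite_autocorrelation.
- exact: positive_definiteD.
- exact: positive_definiteZ.
Qed.

Lemma autocorrelation_shift (H : set G) (x : G) s :
  (forall y, H y -> commute x y) -> (forall y, y \in s -> H y) ->
  forall y, autocorrelation (s ++ [seq (x * z)%g | z <- s]) y =
    autocorrelation s y + autocorrelation s y +
    (autocorrelation s (x^-1 * y)%g + autocorrelation s (x * y)%g).
Proof.
move=> xH sH y; rewrite /autocorrelation big_cat /= big_map.
under eq_bigr do rewrite big_cat /= big_map.
under [X in _ + X]eq_bigr do rewrite big_cat /= big_map.
rewrite !big_split /=.
have -> : \sum_(u <- s) \sum_(v <- s) ((y == u * (x * v)^-1)%g%:R : C) =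
          \sum_(u <- s) \sum_(v <- s) (x * y == u * v^-1)%g%:R.
  rewrite [LHS]big_seq [RHS]big_seq; apply: eq_bigr => u us.
  rewrite [LHS]big_seq [RHS]big_seq; apply: eq_bigr => v vs.
  congr (nat_of_bool _)%:R; rewrite invgM mulgA.
  have xu : commute x u := xH _ (sH _ us).
  have xv : commute x v := xH _ (sH _ vs).
  have xuv : (x * (u * v^-1) = u * v^-1 * x)%g.
    have := commuteM xu (commuteV xv); exact.
  apply/eqP/eqP => [->|e]; first by rewrite mulgA xuv mulgK.
  by apply: (can_inj (mulKg x)); rewrite mulgA xuv mulgK.
have -> : \sum_(u <- s) \sum_(v <- s) ((y == x * u * v^-1)%g%:R : C) =
          \sum_(u <- s) \sum_(v <- s) (x^-1 * y == u * v^-1)%g%:R.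
  apply: eq_bigr => u us; apply: eq_bigr => v vs.
  congr (nat_of_bool _)%:R; apply/eqP/eqP => [->|e].
    by rewrite !mulgA mulVg mul1g.
  by rewrite -mulgA -e mulgA mulgV mul1g.
have -> : \sum_(u <- s) \sum_(v <- s) ((y == x * u * (x * v)^-1)%g%:R : C) =
          \sum_(u <- s) \sum_(v <- s) (y == u * v^-1)%g%:R.
  rewrite [LHS]big_seq [RHS]big_seq; apply: eq_bigr => u us.
  rewrite [LHS]big_seq [RHS]big_seq; apply: eq_bigr => v vs.
  congr (nat_of_bool (y == _))%:R.
  have xu : commute x u := xH _ (sH _ us).
  have xv : commute x v := xH _ (sH _ vs).
  by rewrite xu xv invgM mulgA mulgK.
ring.
Qed.

(** On a generator the result is [(1 - 2 * c)] times the autocorrelation of [s] plus [c] times that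
    of [s] joined with its translate by [x]; the hypothesis [2 * c <= 1] makes both weights
    nonnegative. *)
Lemma autocorrelation_cone_riesz (H : set G) (x : G) (c : C) p :
  H x -> (forall y z, H y -> H z -> H (y * z)%g) ->
  (forall y, H y -> commute x y) -> 0 <= c -> 2 * c <= 1 ->
  autocorrelation_cone H p ->
  autocorrelation_cone H (fun y => p y + c * (p (x^-1 * y)%g + p (x * y)%g)).
Proof.
move=> Hx HM xH c0 c1; elim=> [s sH|q r _ cq _ cr|a q a0 _ cq].
- rewrite (_ : (fun y => _) = fun y => (1 - 2 * c) * autocorrelation s y +
      c * autocorrelation (s ++ [seq (x * z)%g | z <- s]) y).
    apply: autocorrelation_coneD.
      by apply: autocorrelation_coneZ; [rewrite subr_ge0|constructor].
    apply: autocorrelation_coneZ => //; constructor => y.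
    rewrite mem_cat => /orP[/sH//|/mapP[z /sH Hz ->]].
    exact: HM.
  by apply/funext => y; rewrite (autocorrelation_shift xH sH); ring.
- rewrite (_ : (fun y => _) = fun y =>
      (q y + c * (q (x^-1 * y)%g + q (x * y)%g)) +
      (r y + c * (r (x^-1 * y)%g + r (x * y)%g))).
    exact: autocorrelation_coneD.
  by apply/funext => y; ring.
- rewrite (_ : (fun y => _) = fun y =>
      a * (q y + c * (q (x^-1 * y)%g + q (x * y)%g))).
    exact: autocorrelation_coneZ.
  by apply/funext => y; ring.
Qed.

End positive_definite_functions.

Section fourier_stieltjes_norm.
Variables (R : realType) (G : groupType).
Local Notation C := R[i].

(* [fs_le g r]: [g] is a combination [\sum_k c_k p_k] of positive definite
   functions with [\sum_k |c_k| p_k(1) <= r]. *)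
Inductive fs_le : (G -> C) -> R -> Prop :=
| fs_le_pd p r : positive_definite p -> p 1%g <= (r%:C)%C -> fs_le p r
| fs_leD g h r s : fs_le g r -> fs_le h s -> fs_le (fun x => g x + h x) (r + s)
| fs_leZ a g r : fs_le g r -> fs_le (fun x => a * g x) (normc a * r).

Lemma fs_le_ge0 g r : fs_le g r -> 0 <= r.
Proof.
elim=> [p s pp ps|{}g h {}r s _ r0 _ s0|a {}g {}r _ r0].
- by rewrite -lecR; exact: le_trans (positive_definite1 pp) ps.
- exact: addr_ge0.
- by rewrite mulr_ge0// normc_ge0.
Qed.

Lemma fs_leM g h r s :
  fs_le g r -> fs_le h s -> fs_le (fun x => g x * h x) (r * s).
Proof.
move=> gr; elim: gr h s => {g r} [p r pp pr|g g' r r' _ IH _ IH'|a g r _ IH] h s.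
- elim=> [q t qp qt|g' h' t t' _ IH _ IH'|a g' t _ IH].
  + apply: fs_le_pd; first exact: positive_definiteM.
    by rewrite rmorphM ler_pM ?positive_definite1.
  + rewrite mulrDr (_ : (fun x => _) = fun x => p x * g' x + p x * h' x).
      exact: fs_leD.
    by apply/funext => x; rewrite mulrDr.
  + rewrite mulrCA (_ : (fun x => _) = fun x => a * (p x * g' x)).
      exact: fs_leZ.
    by apply/funext => x; rewrite mulrCA.
- move=> hs; rewrite mulrDl (_ : (fun x => _) = fun x => g x * h x + g' x * h x).
    by apply: fs_leD; [exact: IH|exact: IH'].
  by apply/funext => x; rewrite mulrDl.
- move=> hs; rewrite -mulrA (_ : (fun x => _) = fun x => a * (g x * h x)).
    by apply: fs_leZ; exact: IH.
  by apply/funext => x; rewrite mulrA.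
Qed.

Lemma fs_le_exists g : fourier_stieltjes_set g -> exists r, fs_le g r.
Proof.
move=> [n [c [p [pp ->]]]].
elim: n c p pp => [|n IH] c p pp.
  exists 0; rewrite (_ : (fun x => _) = fun=> 0).
    apply: fs_le_pd; last by [].
    by move=> m d h; rewrite !big1// => i _; rewrite big1// => j _; rewrite mulr0.
  by apply/funext => x; rewrite big_ord0.
have [r IHr] := IH (fun k => c (lift ord0 k)) (fun k => p (lift ord0 k)) (fun k => pp _).
exists (normc (c ord0) * complex.Re (p ord0 1%g) + r).
rewrite (_ : (fun x => _) = fun x => c ord0 * p ord0 x +
    \sum_(k < n) c (lift ord0 k) * p (lift ord0 k) x).
  apply: fs_leD => //; apply: fs_leZ; apply: fs_le_pd => //.
  by rewrite RRe_real// ger0_real// positive_definite1.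
by apply/funext => x; rewrite big_ord_recl.
Qed.

End fourier_stieltjes_norm.

(** * Elements of the group algebra as test functionals on B(G) *)

Section group_algebra_elements.
Variables (R : realType) (G : groupType).
Local Notation C := R[i].
Implicit Types (U V : seq (C * G)) (p g h : G -> C) (x y : G).

(** A list [U] stands for the group algebra element with coefficients [u.1] at [u.2]. With [p]
    extended linearly, [ga_form p x U V] below is the value of [p] at the adjoint of [V] times [x]
    times [U]. *)
Definition ga_pair U g : C := \sum_(u <- U) u.1 * g u.2.

Definition ga_form p x U V : C :=
  \sum_(u <- U) \sum_(v <- V) u.1 * v.1^* * p (v.2^-1 * x * u.2)%g.

Definition ga_shift (a : C) x U := [seq (a * u.1, (x * u.2)%g) | u <- U].

Lemma ga_form_ge0 p U : positive_definite p -> 0 <= ga_form p 1 U U.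
Proof.
move=> pp; rewrite /ga_form big_tnth.
have := pp _ (fun i => (tnth (in_tuple U) i).1) (fun i => (tnth (in_tuple U) i).2).
congr (0 <= _); apply: eq_bigr => i _; rewrite [RHS]big_tnth.
by apply: eq_bigr => j _; rewrite mulg1.
Qed.

Lemma ga_form_catl p x U U' V :
  ga_form p x (U ++ U') V = ga_form p x U V + ga_form p x U' V.
Proof. by rewrite /ga_form big_cat. Qed.

Lemma ga_form_catr p x U V V' :
  ga_form p x U (V ++ V') = ga_form p x U V + ga_form p x U V'.
Proof. by rewrite /ga_form -big_split; apply: eq_bigr => u _; rewrite big_cat. Qed.

Lemma ga_form_shiftl p x a y U V :
  ga_form p x (ga_shift a y U) V = a * ga_form p (x * y)%g U V.
Proof.
rewrite /ga_form big_map mulr_sumr; apply: eq_bigr => u _.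
rewrite mulr_sumr; apply: eq_bigr => v _ /=.
by rewrite -!mulrA !mulgA.
Qed.

Lemma ga_form_shiftr p x a y U V :
  ga_form p x U (ga_shift a y V) = a^* * ga_form p (y^-1 * x)%g U V.
Proof.
rewrite /ga_form mulr_sumr; apply: eq_bigr => u _.
rewrite big_map mulr_sumr; apply: eq_bigr => v _ /=.
by rewrite invgM !mulgA rmorphM /=; ring.
Qed.

Definition ga_step (b : R) x U :=
  U ++ ga_shift ('i * (b%:C)%C) x U ++ ga_shift ('i * (b%:C)%C) x^-1%g U.

(** The step multiplies [U] by [1 + i b t] with [t = x + x^-1] self-adjoint, so the terms linear in
    [b] cancel and [1 + b^2 t^2] remains. The gap [4 - t^2] is the adjoint of [x - x^-1] times
    [x - x^-1], hence contributes a nonnegative form. *)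
Lemma ga_form_step p b x U : positive_definite p ->
  ga_form p 1 (ga_step b x U) (ga_step b x U) <=
    ((1 + 4 * b ^+ 2)%:C)%C * ga_form p 1 U U.
Proof.
move=> pp.
have := ga_form_ge0 (ga_shift 1 x U ++ ga_shift (-1) x^-1%g U) pp.
rewrite /ga_step !(ga_form_catl, ga_form_catr, ga_form_shiftl, ga_form_shiftr).
rewrite !(mul1g, mulg1, mulVg, mulgV, invgK).
rewrite rmorphM /= conjCi conjC1 rmorphN1 !mul1r !mulN1r ?opprK.
have -> : ((b%:C)%C)^* = (b%:C)%C :> C by apply: conj_Creal; rewrite complex_real.
set F := ga_form p 1 U U; set F2 := ga_form p (x * x) U U.
set F2' := ga_form p (x^-1 * x^-1) U U.
set F1 := ga_form p x U U; set F1' := ga_form p x^-1 U U.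
set B := (b%:C)%C => F0.
have -> : ((1 + 4 * b ^+ 2)%:C)%C = 1 + 4 * B ^+ 2 :> C.
  by rewrite rmorphD rmorphM rmorphXn /= rmorph_nat rmorph1.
rewrite -subr_ge0.
have B0 : 0 <= B ^+ 2 by rewrite /B -rmorphXn /= lecR sqr_ge0.
have := mulr_ge0 B0 F0; congr (0 <= _).
have ii : 'i * 'i = -1 :> C by rewrite -expr2 sqrCi.
(* The vanishing multiple of [1 + 'i * 'i] makes this a polynomial identity with ['i] as an
   indeterminate. *)
transitivity ((B ^+ 2 * (2 * F - F2 - F2') + (1 + 'i * 'i) * B^+2 * (2 * F + F2 + F2'))).
  by rewrite ii; ring.
ring.
Qed.

(** A form of the Cauchy-Schwarz inequality without square roots: positivity at [U] minus [t] times
    the unit, where [t] is the phase of the pairing. *)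
Lemma ga_pair_le p U K : positive_definite p -> 0 <= K ->
  ga_form p 1 U U <= (K%:C)%C * p 1%g -> 2 * `|ga_pair U p| <= ((K + 1)%:C)%C * p 1%g.
Proof.
move=> pp K0 UK; set b := ga_pair U p.
have p1 := positive_definite1 pp.
have K1 : 0 <= ((K + 1)%:C)%C :> C by rewrite lecR addr_ge0.
have [->|b0] := eqVneq b 0; first by rewrite normr0 mulr0 mulr_ge0.
pose t := b / `|b|.
have nb : `|b| != 0 by rewrite normr_eq0.
have tt : t * t^* = 1.
  by rewrite -normCK /t normrM normfV normr_id mulfV// expr1n.
have tb : t^* * b = `|b|.
  rewrite /t rmorphM /= fmorphV /= conj_normC mulrAC -[_^* * b]mulrC -normCK.
  by rewrite expr2 mulfK.
have tb' : t * b^* = `|b|.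
  by rewrite -[RHS]conj_normC -tb rmorphM /= conjCK.
have := ga_form_ge0 (U ++ [:: (- t, 1%g)]) pp.
rewrite !(ga_form_catl, ga_form_catr).
have -> : ga_form p 1 U [:: (- t, 1%g)] = - `|b|.
  rewrite -tb /ga_form /b /ga_pair mulr_sumr -sumrN; apply: eq_bigr => u _.
  by rewrite big_seq1 /= invg1 !mul1g rmorphN /=; ring.
have -> : ga_form p 1 [:: (- t, 1%g)] U = - `|b|.
  rewrite -tb' /ga_form /b /ga_pair big_seq1 rmorph_sum mulr_sumr -sumrN.
  apply: eq_bigr => u _ /=.
  by rewrite !mulg1 positive_definiteV// rmorphM /=; ring.
have -> : ga_form p 1 [:: (- t, 1%g)] [:: (- t, 1%g)] = p 1%g.
  rewrite /ga_form !big_seq1 /= invg1 !mul1g rmorphN /=.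
  by rewrite mulrNN tt mul1r.
move=> le; rewrite -subr_ge0.
rewrite -subr_ge0 in UK; have := addr_ge0 UK le; congr (0 <= _).
by rewrite rmorphD rmorph1; ring.
Qed.

Lemma ga_pair_fs_le U K g r : 0 <= K ->
  (forall p, positive_definite p -> ga_form p 1 U U <= (K%:C)%C * p 1%g) ->
  fs_le g r -> 2 * normc (ga_pair U g) <= (K + 1) * r.
Proof.
move=> K0 UK; elim=> [p s pp ps|{}g h {}r s _ IHg _ IHh|a {}g {}r _ IH].
- rewrite -lecR rmorphM /= rmorph_nat -norm_normc.
  apply: le_trans (ga_pair_le pp K0 (UK _ pp)) _.
  by rewrite [leRHS]rmorphM ler_wpM2l// lecR addr_ge0.
- rewrite (_ : ga_pair U _ = ga_pair U g + ga_pair U h).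
    have := normcD (ga_pair U g) (ga_pair U h).
    by rewrite mulrDr; lra.
  by rewrite /ga_pair -big_split; apply: eq_bigr => u _; rewrite mulrDr.
- rewrite (_ : ga_pair U _ = a * ga_pair U g).
    by rewrite normcM mulrCA [leRHS]mulrCA ler_wpM2l// normc_ge0.
  by rewrite /ga_pair mulr_sumr; apply: eq_bigr => u _; rewrite mulrCA.
Qed.

Lemma ga_pair_step b x U g (a : R) :
  {in U, forall u, g (x * u.2)%g = (a%:C)%C * g u.2} ->
  {in U, forall u, g (x^-1 * u.2)%g = (a%:C)%C * g u.2} ->
  ga_pair (ga_step b x U) g = (1 + 'i * ((2 * b * a)%:C)%C) * ga_pair U g.
Proof.
move=> gx gx'.
have sh y : {in U, forall u, g (y * u.2)%g = (a%:C)%C * g u.2} ->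
    ga_pair (ga_shift ('i * (b%:C)%C) y U) g = 'i * (b%:C)%C * (a%:C)%C * ga_pair U g.
  move=> gy; rewrite /ga_pair big_map mulr_sumr big_seq [RHS]big_seq.
  by apply: eq_bigr => u uU /=; rewrite gy//; ring.
rewrite /ga_step {1}/ga_pair !big_cat -!/(ga_pair _ _) !sh//.
by rewrite !rmorphM /= rmorph_nat; ring.
Qed.

Fixpoint ga_test (b : R) (x : nat -> G) n : seq (C * G) :=
  if n is n'.+1 then ga_step b (x n') (ga_test b x n') else [:: (1, 1%g)].

Lemma ga_form_test p b (x : nat -> G) n : positive_definite p ->
  ga_form p 1 (ga_test b x n) (ga_test b x n) <=
    (((1 + 4 * b ^+ 2) ^+ n)%:C)%C * p 1%g.
Proof.
move=> pp; elim: n => [|n IH].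
  by rewrite /ga_form !big_seq1 /= expr0 conjC1 invg1 !mul1g !mul1r.
rewrite /= (le_trans (ga_form_step _ _ _ pp))// (exprS _ n) [in leRHS]rmorphM -mulrA.
by rewrite ler_wpM2l// lecR addr_ge0// mulr_ge0// sqr_ge0.
Qed.

End group_algebra_elements.

(** As long as [P k] stays within 1/2 of 1, its real part exceeds 1/2, so each factor raises the
    imaginary part by at least [c k / 2]. The total rise would be at least 1/2, a contradiction. *)
Lemma prod_away_from_1 (R : realType) (c : nat -> R) (P : nat -> R[i]) n :
  (forall k, 0 <= c k) -> P 0%N = 1 ->
  (forall k, (k < n)%N -> P k.+1 = (1 + 'i * ((c k)%:C)%C) * P k) ->
  1 <= \sum_(k < n) c k ->
  exists2 k, (k <= n)%N & 1 / 2 <= normc (P k - 1).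
Proof.
move=> c0 P0 PS c1; apply: contrapT => far.
have near k : (k <= n)%N -> normc (P k - 1) < 1 / 2.
  by move=> kn; rewrite ltNge; apply/negP => Pk; apply: far; exists k.
have abs_re (z : R[i]) : `|complex.Re z| <= normc z.
  case: z => s t /=; rewrite -[leLHS]sqrtr_sqr ler_wsqrtr// lerDl.
  exact: sqr_ge0.
have abs_im (z : R[i]) : `|complex.Im z| <= normc z.
  case: z => s t /=; rewrite -[leLHS]sqrtr_sqr ler_wsqrtr// lerDr.
  exact: sqr_ge0.
have im k : (k <= n)%N -> (\sum_(j < k) c j) / 2 <= complex.Im (P k).
  elim: k => [|k IH] kn; first by rewrite big_ord0 P0 mul0r.
  rewrite big_ord_recr PS//=.
  have := near k (ltnW kn); have := abs_re (P k - 1); have := IH (ltnW kn).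
  case: (P k) => s t /=; simpc; rewrite /= ler_norml => i1 /andP[r1 _] r2.
  have : 1 / 2 * c k <= s * c k by apply: ler_wpM2r => //; lra.
  lra.
have := im n (leqnn n); have := near n (leqnn n); have := abs_im (P n - 1).
case: (P n) => s t /=; simpc; rewrite ler_norml => /andP[_ i1] i2; lra.
Qed.

(** * A lower bound for the norm modulo the point mass at 1 *)

Section norm_lower_bound.
Variables (R : realType) (G : groupType).
Variables (x : nat -> G) (W : nat -> seq G).
Hypothesis W0 : 1%g \in W 0%N.
Hypothesis WS : forall k y, y \in W k ->
  [/\ y \in W k.+1, (x k * y)%g \in W k.+1 & ((x k)^-1 * y)%g \in W k.+1].
Hypothesis xW : forall k y, y \in W k -> (x k * y != 1)%g /\ ((x k)^-1 * y != 1)%g.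

Lemma ga_test_sub (b : R) n u : u \in ga_test b x n -> u.2 \in W n.
Proof.
elim: n u => [|n IH] u /=; first by rewrite inE => /eqP ->.
rewrite !mem_cat => /orP[/IH/WS[]//|/orP[|] /mapP[v /IH/WS[? ? ?] ->]//].
Qed.

(** The first [l ^ 2] test elements have forms bounded by [(1 + l^-2)^(l^2) <= e], while the pairing
    with [g] gains a factor [1 + i a_k / l] each time and so leaves the disc of radius 1/2 around 1.
    All of them pair to 1 with the point mass, so [d] cancels in the difference of two pairings,
    each at most [(e + 1) * r / 2]. *)
Lemma fs_le_lower_bound (g : G -> R[i]) (a : nat -> R) (l : nat) d r :
  (0 < l)%N -> (forall k, 0 <= a k) -> g 1%g = 1 ->
  (forall k y, y \in W k -> g (x k * y)%g = ((a k)%:C)%C * g y) ->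
  (forall k y, y \in W k -> g ((x k)^-1 * y)%g = ((a k)%:C)%C * g y) ->
  l%:R <= \sum_(k < l ^ 2) a k ->
  fs_le (fun y => g y + d * (y == 1%g)%:R) r -> (2 * (expR 1 + 1))^-1 <= r.
Proof.
move=> l0 a0 g1 gx gx' al gr.
have lR : 0 < l%:R :> R by rewrite ltr0n.
pose b : R := (2 * l%:R)^-1.
pose T := ga_test b x.
pose P k := ga_pair (T k) g.
have P0 : P 0%N = 1 by rewrite /P /ga_pair big_seq1 /= g1 mulr1.
have PS k : P k.+1 = (1 + 'i * ((a k / l%:R)%:C)%C) * P k.
  rewrite /P /= (@ga_pair_step _ _ _ _ _ _ (a k)).
  - congr ((1 + 'i * (_%:C)%C) * _); rewrite /b; field.
    by rewrite gt_eqF.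
  - by move=> u /ga_test_sub; exact: gx.
  - by move=> u /ga_test_sub; exact: gx'.
have T1 k : ga_pair (T k) (fun y => (y == 1%g)%:R) = 1.
  elim: k => [|k IH]; first by rewrite /ga_pair big_seq1 /= eqxx mulr1.
  rewrite /= (@ga_pair_step _ _ _ _ _ _ 0) ?IH ?mulr0 ?addr0 ?mulr1//.
  - move=> u /ga_test_sub/xW[/negbTE -> _]; by rewrite mul0r.
  - move=> u /ga_test_sub/xW[_ /negbTE ->]; by rewrite mul0r.
have [| |k kl Pk] := @prod_away_from_1 R (fun k => a k / l%:R) P (l ^ 2)%N _ P0
  (fun k _ => PS k).
- by move=> k; rewrite divr_ge0// ltW.
- by rewrite -mulr_suml ler_pdivlMr// mul1r.
have Tb j : (j <= l ^ 2)%N -> forall p, positive_definite p ->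
    ga_form p 1 (T j) (T j) <= ((expR 1 : R)%:C)%C * p 1%g.
  move=> jl p pp; apply: le_trans (ga_form_test _ _ _ pp) _.
  rewrite ler_wpM2r ?positive_definite1// lecR.
  have b4 : 1 + 4 * b ^+ 2 = 1 + (l%:R ^+ 2)^-1.
    by rewrite /b; field; rewrite gt_eqF.
  have l2 : 0 < (l%:R ^+ 2)^-1 :> R by rewrite invr_gt0 exprn_gt0.
  apply: (@le_trans _ _ ((1 + 4 * b ^+ 2) ^+ (l ^ 2))).
    by apply: ler_weXn2l => //; rewrite b4 lerDl ltW.
  rewrite b4; apply: (@le_trans _ _ (expR ((l%:R ^+ 2)^-1) ^+ (l ^ 2))).
    apply: lerXn2r; rewrite ?nnegrE ?expR_ge0 ?expR_ge1Dx//.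
  rewrite -expRM_natl -natrX mulfV// gt_eqF// natrX.
  by rewrite exprn_gt0.
have e0 : 0 <= expR 1 :> R := expR_ge0 1.
have := ga_pair_fs_le e0 (Tb k kl) gr; have := ga_pair_fs_le e0 (Tb 0%N (leq0n _)) gr.
have Td j : ga_pair (T j) (fun y => g y + d * (y == 1%g)%:R) = P j + d.
  rewrite -[d in RHS]mulr1 -[in RHS](T1 j) /P /ga_pair mulr_sumr -big_split.
  by apply: eq_bigr => u _ /=; rewrite mulrDr mulrCA.
rewrite !Td P0 => b0 bk.
have : normc (P k - 1) <= normc (P k + d) + normc (1 + d).
  rewrite -(normcN (1 + d)); have -> : P k - 1 = (P k + d) + - (1 + d) by ring.
  exact: normcD.
have e10 : 0 < 2 * (expR 1 + 1) :> R by rewrite mulr_gt0// addr_gt0// expR_gt0.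
move=> le3; rewrite -[leLHS]mul1r ler_pdivrMr//; lra.
Qed.

End norm_lower_bound.

(** * Riesz products *)

Section dissociate_sequences.
Variables (G : groupType) (H : set G).
Hypothesis Hgroup : group_closed (mem H).
Hypothesis Habelian : {in H &, forall x y, commute x y}.
Hypothesis Hinfinite : infinite_set H.

Lemma group_closed1P : H 1%g.
Proof. by case: Hgroup => + _; rewrite inE. Qed.

Lemma group_closedVP x : H x -> H x^-1%g.
Proof.
move=> Hx; have := group_closedV Hgroup; move=> /(_ x).
by rewrite !inE; apply.
Qed.

Lemma group_closedMP x y : H x -> H y -> H (x * y)%g.
Proof.
move=> Hx Hy; have := group_closedM Hgroup; move=> /(_ x y).
by rewrite !inE; apply.
Qed.

Lemma abelian_commute x y : H x -> H y -> commute x y.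
Proof. by move=> Hx Hy; apply: Habelian; rewrite inE. Qed.

(* If every [x] outside [D] had [x ^ 2] in [D \ {1}], then squaring would have
   an infinite fibre, hence infinitely many involutions, all lying in [D]. *)
Lemma exists_dissociate (D : seq G) :
  exists x, [/\ H x, x \notin D & (x * x = 1)%g \/ (x * x)%g \notin D].
Proof.
apply: contrapT => no.
have {}no x : H x -> x \notin D -> (x * x != 1)%g /\ (x * x)%g \in D.
  move=> Hx xD; split.
    by apply/eqP => xx; apply: no; exists x; split => //; left.
  by apply/negPn/negP => xx; apply: no; exists x; split => //; right.
apply: Hinfinite.
have fin w : finite_set [set x | H x /\ (x * x = w)%g].
  have [[x0 [Hx0 x0w]]|none] := pselect (exists x, H x /\ (x * x = w)%g); last first.
    rewrite (_ : [set _ | _] = set0)//; apply/seteqP; split => // x xw.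
    by apply: none; exists x.
  apply: (@sub_finite_set _ _ [set (y * x0)%g | y in [set` D]]); last first.
    exact/finite_image/finite_seq.
  move=> x [Hx xw]; exists (x * x0^-1)%g; last by rewrite mulgVK.
  apply/negPn/negP => xx0.
  have [|+ _] := no (x * x0^-1)%g _ xx0.
    exact/group_closedMP/group_closedVP.
  case/eqP; have cx : commute x x0^-1%g by apply/commuteV/abelian_commute.
  rewrite mulgA -[(x * x0^-1 * x)%g]mulgA -cx mulgA xw -mulgA.
  by rewrite -invgM x0w mulgV.
apply: (@sub_finite_set _ _
  ([set` D] `|` \bigcup_(w in [set` D]) [set x | H x /\ (x * x = w)%g])).
  move=> x Hx; have [xD|xD] := boolP (x \in D); first by left.
  by right; exists (x * x)%g; [exact: (no x Hx xD).2|].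
rewrite finite_setU; split; first exact: finite_seq.
by apply: bigcup_finite => //; exact: finite_seq.
Qed.

(** [W k] lists the products of the [x j], [j < k], with exponents -1, 0 or 1. The alternative
    [x k * x k = 1] is allowed because [H] may have exponent two. *)
Definition dissociate (x : nat -> G) (W : nat -> seq G) : Prop :=
  [/\ W 0%N = [:: 1%g],
      forall k, W k.+1 = W k ++ [seq (x k * y)%g | y <- W k] ++
                         [seq ((x k)^-1 * y)%g | y <- W k],
      forall k, H (x k),
      forall k y z, y \in W k -> z \in W k -> (x k * y != z)%g &
      forall k, (x k * x k = 1)%g \/
        forall y z, y \in W k -> z \in W k -> (x k * x k * y != z)%g].

(** Each [x k] is picked outside the finite set of quotients of elements of [W k], with its square
    either trivial or outside that set too. *)
Lemma exists_dissociate_sequence : exists x W, dissociate x W.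
Proof.
have [pick pickP] := choice exists_dissociate.
pose quot (V : seq G) := [seq (z * y^-1)%g | z <- V, y <- V].
pose next V := V ++ [seq (pick (quot V) * y)%g | y <- V] ++
                    [seq ((pick (quot V))^-1 * y)%g | y <- V].
pose W k := iter k next [:: 1%g].
have quotP V u y z : u \notin quot V -> y \in V -> z \in V -> (u * y != z)%g.
  move=> uV yV zV; apply: contraNN uV => /eqP uyz; apply/allpairsP.
  by exists (z, y); split => //=; rewrite -uyz mulgK.
exists (fun k => pick (quot (W k))), W; split => //= k.
- by case: (pickP (quot (W k))).
- by move=> y z; apply: quotP; case: (pickP (quot (W k))).
- case: (pickP (quot (W k))) => _ _ [|sq]; first by left.
  by right => y z; exact: quotP.
Qed.

End dissociate_sequences.

Section riesz_products.
Variables (G : groupType) (H : set G).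
Variables (x : nat -> G) (W : nat -> seq G).
Hypothesis xW : dissociate H x W.

Lemma dissociate_subS k : {subset W k <= W k.+1}.
Proof. by case: xW => _ WS _ _ _ y yW; rewrite WS mem_cat yW. Qed.

Lemma dissociate_sub k m : (k <= m)%N -> {subset W k <= W m}.
Proof.
elim: m => [|m IH]; first by rewrite leqn0 => /eqP ->.
rewrite leq_eqVlt => /predU1P[->//|/IH km] y /km.
exact: dissociate_subS.
Qed.

Lemma dissociate_mem k y : y \in W k ->
  [/\ y \in W k.+1, (x k * y)%g \in W k.+1 & ((x k)^-1 * y)%g \in W k.+1].
Proof.
move=> yW; split; first exact: dissociate_subS.
  by case: xW => _ -> _ _ _; rewrite !mem_cat map_f// orbT.
by case: xW => _ -> _ _ _; rewrite !mem_cat (map_f (fun z => (x k)^-1 * z)%g) ?orbT.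
Qed.

Lemma dissociate1 k : 1%g \in W k.
Proof. by apply: (dissociate_sub (leq0n k)); case: xW => -> _ _ _ _; rewrite inE. Qed.

Lemma dissociate_notin k y : y \in W k ->
  (x k * y)%g \notin W k /\ ((x k)^-1 * y)%g \notin W k.
Proof.
case: xW => _ _ _ xN _ yW; split; apply/negP => xyW.
  by have := xN k _ _ yW xyW; rewrite eqxx.
by have := xN k _ _ xyW yW; rewrite mulgA mulgV mul1g eqxx.
Qed.

Lemma dissociate_sqr k y : (x k * x k != 1)%g -> y \in W k ->
  (x k * (x k * y))%g \notin W k /\ ((x k)^-1 * ((x k)^-1 * y))%g \notin W k.
Proof.
case: xW => _ _ _ _ /(_ k)[->|xN]; first by rewrite eqxx.
move=> _ yW; split; apply/negP => xyW.
  by have := xN _ _ yW xyW; rewrite mulgA eqxx.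
by have := xN _ _ xyW yW; rewrite !mulgA mulgK mulgV mul1g eqxx.
Qed.

Lemma dissociate_decomp m y : y \in W m -> y != 1%g ->
  exists k w, [/\ w \in W k, y \notin W k, (k < m)%N &
                  y = (x k * w)%g \/ y = ((x k)^-1 * w)%g].
Proof.
elim: m => [|m IH]; first by case: xW => -> _ _ _ _; rewrite inE => /eqP ->; rewrite eqxx.
have [yW _ y1|yW] := boolP (y \in W m).
  by have [k [w [? ? km ?]]] := IH yW y1; exists k, w; split => //; exact: ltnW.
case: xW => _ -> _ _ _; rewrite !mem_cat (negbTE yW) /=.
by case/orP => /mapP[w wW ye] _; exists m, w; split => //; [left|right].
Qed.

Section riesz.
Variables (R : realType) (c : nat -> R).

(** The coefficients of the product over [k < n] of [1 + c_k (x_k + x_k^-1)] in the group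
    algebra. *)
Fixpoint riesz_partial n (y : G) : R :=
  if n is k.+1 then
    riesz_partial k y +
      c k * (riesz_partial k ((x k)^-1 * y)%g + riesz_partial k (x k * y)%g)
  else (y == 1%g)%:R.

(** On [W n] the partial products are stationary from [n] on, so the choice of index is immaterial.
    Outside every [W n] the default index 0 gives the value 0. *)
Definition riesz (y : G) : R := riesz_partial (xget 0%N [set n | y \in W n]) y.

(* For an involution [x k] the two shifts in the Riesz factor coincide. *)
Definition riesz_coef k : R := c k * (1 + (x k * x k == 1)%g%:R).

Lemma riesz_partial_out n y : y \notin W n -> riesz_partial n y = 0.
Proof.
elim: n y => [|n IH] y.
  by case: xW => -> _ _ _ _; rewrite inE => /negbTE /= ->.
move=> yW /=.
have shift z : z \in W n -> y != (x n * z)%g /\ y != ((x n)^-1 * z)%g.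
  move=> /dissociate_mem[_ xz xz']; split; apply: contraNneq yW => ->//.
have yW' : y \notin W n by apply: contraNN yW; exact: dissociate_subS.
rewrite (IH _ yW') add0r !IH ?addr0 ?mulr0//.
  apply/negP => /shift[_]; by rewrite mulgA mulVg mul1g eqxx.
apply/negP => /shift[]; by rewrite mulgA mulgV mul1g eqxx.
Qed.

Lemma riesz_partialS n y : y \in W n -> riesz_partial n.+1 y = riesz_partial n y.
Proof.
move=> /dissociate_notin[xy xy'] /=.
by rewrite (riesz_partial_out xy) (riesz_partial_out xy') addr0 mulr0 addr0.
Qed.

(** By dissociateness only the term returning to [y] survives; for an involution both shifts return
    to [y], whence the doubled coefficient. *)
Lemma riesz_partial_shift n y : y \in W n ->
  riesz_partial n.+1 (x n * y)%g = riesz_coef n * riesz_partial n y /\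
  riesz_partial n.+1 ((x n)^-1 * y)%g = riesz_coef n * riesz_partial n y.
Proof.
move=> yW; have [xy xy'] := dissociate_notin yW.
rewrite /= !(riesz_partial_out xy) !(riesz_partial_out xy').
rewrite !mulgA mulVg mulgV mul1g !add0r /riesz_coef -!mulgA.
have [xx|xx] := eqVneq (x n * x n)%g 1%g.
  have xV : ((x n)^-1 = x n)%g by rewrite -[RHS](mulKg (x n)) xx mulg1.
  by rewrite xV mulgA xx mul1g mulr1n; split; ring.
have [sy sy'] := dissociate_sqr xx yW.
by rewrite (riesz_partial_out sy) (riesz_partial_out sy') mulr0n; split; ring.
Qed.

Lemma riesz_partial_sub m n y : (m <= n)%N -> y \in W m ->
  riesz_partial n y = riesz_partial m y.
Proof.
move=> + yW; elim: n => [|n IH]; first by rewrite leqn0 => /eqP ->.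
rewrite leq_eqVlt => /predU1P[->//|mn].
rewrite riesz_partialS; first exact: IH.
exact: (dissociate_sub (mn : (m <= n)%N) yW).
Qed.

Lemma rieszE n y : y \in W n -> riesz y = riesz_partial n y.
Proof.
move=> yW; rewrite /riesz; case: xgetP => [m _ /= yWm|/(_ n)//].
have [mn|/ltnW nm] := leqP m n; first by rewrite (riesz_partial_sub mn).
by rewrite (riesz_partial_sub nm).
Qed.

Lemma riesz_out y : (forall n, y \notin W n) -> riesz y = 0.
Proof. by move=> yW; exact: riesz_partial_out. Qed.

Lemma riesz1 : riesz 1%g = 1.
Proof. by rewrite (rieszE (dissociate1 0)) /= eqxx. Qed.

Lemma riesz_shift n y : y \in W n ->
  riesz (x n * y)%g = riesz_coef n * riesz y /\
  riesz ((x n)^-1 * y)%g = riesz_coef n * riesz y.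
Proof.
move=> yW; have [_ xy xy'] := dissociate_mem yW.
by rewrite (rieszE xy) (rieszE xy') (rieszE yW); exact: riesz_partial_shift.
Qed.

Lemma riesz_decomp y : y != 1%g ->
  (forall n, y \notin W n) \/
  exists k w, [/\ w \in W k, y \notin W k, y \in W k.+1 &
    y = (x k * w)%g \/ y = ((x k)^-1 * w)%g].
Proof.
move=> y1; have [[n yW]|out] := pselect (exists n, y \in W n); last first.
  by left => n; apply/negP => yW; apply: out; exists n.
right; have [k [w [wW yW' _ ye]]] := dissociate_decomp yW y1.
exists k, w; split => //.
by have [_ xw xw'] := dissociate_mem wW; case: ye => ->.
Qed.

Hypothesis c_ge0 : forall k, 0 <= c k.
Hypothesis c_le : forall k, c k <= 1 / 4.

Lemma riesz_coef_ge k : c k <= riesz_coef k.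
Proof. by rewrite /riesz_coef mulrDr mulr1 lerDl mulr_ge0. Qed.

Lemma riesz_coef_ge0 k : 0 <= riesz_coef k.
Proof. exact: le_trans (riesz_coef_ge k). Qed.

Lemma riesz_coef_le k : riesz_coef k <= 2 * c k.
Proof.
rewrite /riesz_coef; have := c_ge0 k.
by case: (_ == _) => /=; lra.
Qed.

Lemma riesz_ge0_le1 y : 0 <= riesz y <= 1.
Proof.
have [[n]|out] := pselect (exists n, y \in W n); last first.
  by rewrite riesz_out ?lexx ?ler01// => n; apply/negP => yW; apply: out; exists n.
elim/ltn_ind: n y => n IH y yW.
have [->|y1] := eqVneq y 1%g; first by rewrite riesz1 ler01 lexx.
have [k [w [wW _ kn ye]]] := dissociate_decomp yW y1.
have /andP[w0 w1] := IH k kn w wW.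
have -> : riesz y = riesz_coef k * riesz w.
  by have [s s'] := riesz_shift wW; case: ye => ->.
have := riesz_coef_ge0 k; have := riesz_coef_le k; have := c_le k => k1 k2 k3.
by rewrite mulr_ge0//= mulr_ile1//; lra.
Qed.

(** An element outside [W n] has its last factor at some stage [k >= n]; that factor contributes at
    most [2 * c k], and the rest at most 1. *)
Lemma riesz_le n e y : 0 <= e -> (forall k, (n <= k)%N -> 2 * c k <= e) ->
  y != 1%g -> y \notin W n -> riesz y <= e.
Proof.
move=> e0 ce y1 yW; have [out|[k [w [wW yWk yWk' ye]]]] := riesz_decomp y1.
  by rewrite riesz_out.
have nk : (n <= k)%N.
  by rewrite leqNgt; apply: contraNN yW => /dissociate_sub; exact.
have -> : riesz y = riesz_coef k * riesz w.
  by have [s s'] := riesz_shift wW; case: ye => ->.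
have /andP[w0 w1] := riesz_ge0_le1 w.
apply: le_trans (ce k nk); apply: le_trans (riesz_coef_le k).
by rewrite -[leRHS]mulr1 ler_wpM2l// riesz_coef_ge0.
Qed.

Lemma riesz_le_half y : y != 1%g -> riesz y <= 1 / 2.
Proof.
move=> y1; apply: (@riesz_le 0) => //; last by case: xW => -> _ _ _ _; rewrite inE.
by move=> k _; have := c_le k; lra.
Qed.

Lemma riesz_positive_definite :
  (forall y z, H y -> H z -> H (y * z)%g) -> H 1%g ->
  (forall y z, H y -> H z -> commute y z) ->
  positive_definite (fun y => ((riesz y)%:C)%C : R[i]).
Proof.
move=> HM H1 Hc.
have cone n : autocorrelation_cone H (fun y => ((riesz_partial n y)%:C)%C : R[i]).
  elim: n => [|n IH].
    rewrite (_ : (fun y => _) = autocorrelation R[i] [:: 1%g]).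
      by constructor => y; rewrite inE => /eqP ->.
    apply/funext => y; rewrite /autocorrelation !big_seq1 mulgV /=.
    by rewrite rmorph_nat.
  have Hx : H (x n) by case: xW.
  have c0 : 0 <= ((c n)%:C)%C :> R[i] by rewrite lecR.
  have c1 : 2 * ((c n)%:C)%C <= 1 :> R[i].
    rewrite -(rmorph_nat (real_complex R)) -rmorphM -(rmorph1 (real_complex R)) /=.
    by rewrite lecR; have := c_le n; lra.
  have := autocorrelation_cone_riesz Hx HM (fun y => Hc _ _ Hx) c0 c1 IH.
  congr autocorrelation_cone; apply/funext => y /=.
  by rewrite rmorphD rmorphM rmorphD.
apply: positive_definite_approx => s.
have [n sn] : exists n, {in s, riesz =1 riesz_partial n}.
  have ev y : exists m, forall n, (m <= n)%N -> riesz y = riesz_partial n y.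
    have [[m yW]|out] := pselect (exists m, y \in W m).
      by exists m => n mn; rewrite (riesz_partial_sub mn yW) (rieszE yW).
    have {}out n : y \notin W n by apply/negP => yW; apply: out; exists n.
    by exists 0%N => n _; rewrite riesz_out// riesz_partial_out.
  have [N NP] := choice ev.
  exists (\max_(y <- s) N y)%N => y ys; apply: NP.
  exact: leq_bigmax_seq.
exists (fun y => ((riesz_partial n y)%:C)%C).
  exact: autocorrelation_cone_pd (cone n).
by move=> y ys /=; rewrite sn.
Qed.

End riesz.

(** The last stage [k >= n] of [y] does not depend on the weights, so the product contains the
    factor [c k * c' k]. *)
Lemma riesz_disjoint (R : realType) (c c' : nat -> R) n y :
  (forall k, (n <= k)%N -> c k * c' k = 0) -> y \notin W n ->
  riesz c y * riesz c' y = 0.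
Proof.
move=> cc yW.
have [y1|y1] := eqVneq y 1%g; first by rewrite y1 dissociate1 in yW.
have [out|[k [w [wW yWk yWk' ye]]]] := riesz_decomp y1.
  by rewrite !riesz_out ?mul0r.
have nk : (n <= k)%N.
  by rewrite leqNgt; apply: contraNN yW => /dissociate_sub; exact.
have cE (d : nat -> R) : riesz d y = riesz_coef d k * riesz d w.
  by have [s s'] := riesz_shift d wW; case: ye => ->.
rewrite !cE mulrACA [X in X * _](_ : _ = 0) ?mul0r//.
by rewrite /riesz_coef mulrACA cc// mul0r.
Qed.

End riesz_products.

(** * Characters of B(G) *)

Lemma positive_definite_delta1 (C : numClosedFieldType) (G : groupType) :
  positive_definite (fun y : G => (y == 1%g)%:R : C).
Proof.
rewrite (_ : (fun y => _) = autocorrelation C [:: 1%g]).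
  exact: positive_definite_autocorrelation.
by apply/funext => y; rewrite /autocorrelation !big_seq1 mulgV.
Qed.

Section fourier_stieltjes_ring.
Variables (R : realType) (G : groupType).
Local Notation C := R[i].

Definition fs_pred : pred (G -> C) := fun g => g \in @fourier_stieltjes_set R G.

Lemma fs_predP (g : G -> C) : reflect (fourier_stieltjes_set g) (g \in fs_pred).
Proof. by apply: (iffP idP) => [/set_mem|gF]; last exact: mem_set. Qed.

Lemma fs_cst (z : C) : (fun=> z) \in fs_pred.
Proof.
apply/fs_predP; rewrite (_ : (fun=> z) = fun x => z * 1).
  exact/fourier_stieltjesZ/fourier_stieltjes_pd/positive_definite_cst1.
by apply/funext => x; rewrite mulr1.
Qed.

Lemma fs_subring_closed : subring_closed fs_pred.
Proof.
split; first exact: fs_cst.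
  move=> g h /fs_predP gF /fs_predP hF; apply/fs_predP.
  rewrite (_ : g - h = fun x => g x + (-1) * h x).
    by apply: fourier_stieltjesD => //; exact: fourier_stieltjesZ.
  by apply/funext => x; rewrite mulN1r.
move=> g h /fs_predP gF /fs_predP hF; apply/fs_predP.
exact: fourier_stieltjesM.
Qed.

(** The construction of characters needs a ring containing the constants, hence is carried out on
    B(G); for the smaller algebra the resulting characters are restricted. *)
Record fs_ring := FsRing { fs_fun :> G -> C; _ : fs_fun \in fs_pred }.

HB.instance Definition _ := [isSub for fs_fun].
HB.instance Definition _ := [Choice of fs_ring by <:].
HB.instance Definition _ :=
  GRing.SubChoice_isSubComPzRing.Build (G -> C) fs_pred fs_ring
    fs_subring_closed.

Lemma fs_ring_neq0 : 1 != 0 :> fs_ring.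
Proof.
apply/eqP => /(congr1 (fun g : fs_ring => g 1%g)).
by apply/eqP; exact: oner_neq0.
Qed.

HB.instance Definition _ := GRing.PzSemiRing_isNonZero.Build fs_ring fs_ring_neq0.

Definition fs_iota (z : C) : fs_ring := FsRing (fs_cst z).

Lemma fs_iota_is_zmod_morphism : zmod_morphism fs_iota.
Proof. by move=> z w; apply: val_inj. Qed.

Lemma fs_iota_is_monoid_morphism : monoid_morphism fs_iota.
Proof. by split; [|move=> z w]; apply: val_inj. Qed.

HB.instance Definition _ :=
  GRing.isZmodMorphism.Build C fs_ring fs_iota fs_iota_is_zmod_morphism.
HB.instance Definition _ :=
  GRing.isMonoidMorphism.Build C fs_ring fs_iota fs_iota_is_monoid_morphism.

End fourier_stieltjes_ring.

Section characters.
Variables (R : realType) (G : groupType).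
Local Notation C := R[i].
Variables (f : G -> C) (d0 : R).
Hypothesis fpd : positive_definite f.
Hypothesis f1 : f 1%g = 1.
Hypothesis d0_gt0 : 0 < d0.
Hypothesis f_lower : forall n d r,
  fs_le (fun y => f y ^+ n + d * (y == 1%g)%:R) r -> d0 <= r.

Let fX n : fs_le (fun y => f y ^+ n) 1.
Proof. by apply: fs_le_pd; [exact: positive_definiteX|rewrite f1 expr1n]. Qed.

Let fF : f \in @fs_pred R G.
Proof. exact/fs_predP/fourier_stieltjes_pd. Qed.

(* The seminorm [lim_n || g f ^ n ||] on the quotient by the ideal of multiples
   of the point mass at 1. *)
Let E (g : fs_ring R G) : set R :=
  [set r | exists n d, fs_le (fun y => g y * f y ^+ n + d * (y == 1%g)%:R) r].

Lemma fs_gauge : gauge (@fs_iota R G) (FsRing fF) E.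
Proof.
have fd (y : G) n : f y ^+ n * (y == 1%g)%:R = (y == 1%g)%:R :> C.
  by have [->|] := eqVneq y 1%g; rewrite ?f1 ?expr1n ?mulr0 ?mul1r.
(* Multiplying by [f ^+ m] does not raise the bound and leaves the point mass unchanged since
   [f 1 = 1], so two exponents can be made equal. *)
have Em (g : fs_ring R G) n d r m :
    fs_le (fun y => g y * f y ^+ n + d * (y == 1%g)%:R) r ->
    fs_le (fun y => g y * f y ^+ (n + m) + d * (y == 1%g)%:R) r.
  move=> gr; have := fs_leM gr (fX m); rewrite mulr1.
  congr fs_le; apply/funext => y; rewrite mulrDl exprD -!mulrA.
  by rewrite [_%:R * _]mulrC fd.
split.
- move=> [g gF]; have [r gr] := fs_le_exists (fs_predP _ gF).
  exists r, 0%N, 0; move: gr; congr fs_le; apply/funext => y.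
  by rewrite expr0 mulr1 mul0r addr0.
- by move=> g r [n [d]]; exact: fs_le_ge0.
- move=> g h r s [n [d gr]] [m [e hs]]; exists (n + m)%N, (d + e).
  have := fs_leD (Em _ _ _ _ m gr) (Em _ _ _ _ n hs).
  congr fs_le; apply/funext => y; rewrite (addnC m).
  have -> : (g + h) y = g y + h y by [].
  by ring.
- move=> g h r s [n [d gr]] [m [e hs]].
  (* The coefficient is read off at the identity: [(g 1 + d) * (h 1 + e)] minus [g 1 * h 1]. *)
  exists (n + m)%N, (d * h 1%g + e * g 1%g + d * e).
  have := fs_leM gr hs; congr fs_le; apply/funext => y.
  have -> : (g * h) y = g y * h y by [].
  have [->|_] := eqVneq y 1%g; first by rewrite f1 !expr1n mulr1n; ring.
  by rewrite mulr0n !mulr0 !addr0 exprD; ring.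
- move=> z g r [n [d gr]]; exists n, (z * d).
  have := fs_leZ z gr; congr fs_le; apply/funext => y.
  have -> : (fs_iota G z * g) y = z * g y by [].
  by ring.
- move=> g r; have fgE y : (FsRing fF * g) y = f y * g y by [].
  split => -[n [d gr]].
    exists n.+1, d; move: gr; congr fs_le; apply/funext => y.
    by rewrite fgE exprS; ring.
  exists n, d; have := Em _ _ _ _ 1%N gr; congr fs_le; apply/funext => y.
  by rewrite fgE exprD expr1; ring.
- exists d0 => // r [n [d gr]]; apply: (@f_lower n d); move: gr.
  by congr fs_le; apply/funext => y; rewrite mul1r.
Qed.

Lemma exists_fs_character : exists phi : (G -> C) -> C,
  [/\ forall g h, fourier_stieltjes_set g -> fourier_stieltjes_set h ->
        phi (fun y => g y + h y) = phi g + phi h,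
      forall g h, fourier_stieltjes_set g -> fourier_stieltjes_set h ->
        phi (fun y => g y * h y) = phi g * phi h,
      forall a g, fourier_stieltjes_set g -> phi (fun y => a * g y) = a * phi g,
      phi (fun y => (y == 1%g)%:R) = 0 & normc (phi f) = 1].
Proof.
have [phi [phiD phiM phii phiE phif]] := gauge_character fs_gauge.
(* The character is extended by the value 0 outside B(G), so that it applies to plain functions. *)
have ext (g : G -> C) : exists z, forall gF : g \in @fs_pred R G, z = phi (FsRing gF).
  have [gF|gF] := pselect (g \in @fs_pred R G); last by exists 0.
  by exists (phi (FsRing gF)) => gF'; congr phi; exact: val_inj.
have [psi psiE] := choice ext.
exists psi; split.
- move=> g h /fs_predP gF /fs_predP hF.
  have ghF : (fun y => g y + h y) \in @fs_pred R G.
    by apply/fs_predP; apply: fourier_stieltjesD; exact/fs_predP.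
  rewrite (psiE _ gF) (psiE _ hF) (psiE _ ghF) -phiD; congr phi.
  exact: val_inj.
- move=> g h /fs_predP gF /fs_predP hF.
  have ghF : (fun y => g y * h y) \in @fs_pred R G.
    by apply/fs_predP; apply: fourier_stieltjesM; exact/fs_predP.
  rewrite (psiE _ gF) (psiE _ hF) (psiE _ ghF) -phiM; congr phi.
  exact: val_inj.
- move=> a g /fs_predP gF.
  have agF : (fun y => a * g y) \in @fs_pred R G.
    by apply/fs_predP; apply: fourier_stieltjesZ; exact/fs_predP.
  rewrite (psiE _ gF) (psiE _ agF) -{2}(phii a) -phiM; congr phi.
  exact: val_inj.
- have dF : (fun y : G => (y == 1%g)%:R : C) \in @fs_pred R G.
    exact/fs_predP/fourier_stieltjes_pd/positive_definite_delta1.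
  rewrite (psiE _ dF); apply: eq0_normc; apply/eqP.
  (* Subtracting the point mass from itself shows that 0 is an admissible bound for it. *)
  rewrite eq_le normc_ge0 andbT; apply: phiE; exists 0%N, (-1).
  have := fs_leZ 0 (fX 0%N); rewrite normc0 mul0r; congr fs_le.
  by apply/funext => y /=; rewrite expr0 mul0r; ring.
- by rewrite (psiE _ fF).
Qed.

End characters.

(** * Disjoint open sets of characters *)

Section disjoint_open_sets.
Variables (R : realType).
Local Notation C := R[i].

Lemma open_normc_gt (e : R) : open [set z : C^o | e < normc z].
Proof.
rewrite openE => z /= ez; apply/nbhs_ballP.
exists ((normc z - e)%:C)%C; first by rewrite /= ltcR subr_gt0.
move=> w; rewrite /ball /= norm_normc ltcR => zw.
have := normcD (z - w) w; rewrite subrK; lra.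
Qed.

Lemma realType_uncountable : ~ countable [set: R].
Proof.
move=> Rc; have : countable (`[0, 1]%classic : set R).
  exact: sub_countable (subset_card_le (@subsetT _ _)) Rc.
move=> /countable_lebesgue_measure0; rewrite lebesgue_measure_itv /= lte_fin ltr01.
by rewrite -EFinB subr0 => /eqP; rewrite eqe oner_eq0.
Qed.

Lemma continuum_disjoint_open_not_separable (T : topologicalType) :
  continuum_disjoint_open R T -> ~ separable T.
Proof.
move=> [U [Uo Une Utriv]] [D [Dc Dd]].
have [d dP] := choice (fun t => Dd (U t) (Une t) (Uo t)).
apply: realType_uncountable; apply/countable_injP.
have [g ginj] := countable_injP _ Dc.
exists (g \o d) => s t _ _ /= gst; apply: Utriv => //.
exists (d s); split; first exact: (dP s).1.
have -> : d s = d t by apply: ginj => //; rewrite inE; exact: (dP _).2.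
exact: (dP t).1.
Qed.

Variables (G : groupType) (A : function_algebra C G).

Lemma multiplicative0 (chi : {ptws A -> C^o}) : multiplicative_functionals chi ->
  forall g : A, (forall y, val g y = 0) -> chi g = 0.
Proof.
move=> [_ chiZ _ _] g g0; have -> : g = falg_scale 0 g.
  by apply: val_inj; apply/funext => y; rewrite /= mul0r g0.
by rewrite chiZ mul0r.
Qed.

(* Apply [chi] to [h \prod_(y <- S) (h - h y) = 0]. *)
Lemma multiplicative_finite_range (chi : {ptws A -> C^o}) (S : seq G) (h : A) :
  multiplicative_functionals chi -> (forall y, y \notin S -> val h y = 0) ->
  chi h = 0 \/ exists y, chi h = val h y.
Proof.
move=> chiM hS.
(* The leading factor [h] keeps these products in [A], which may lack constants. *)
have key (s : seq G) : exists g : A,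
    (forall y, val g y = val h y * \prod_(z <- s) (val h y - val h z)) /\
    chi g = chi h * \prod_(z <- s) (chi h - val h z).
  elim: s => [|z s [g [gE chig]]].
    by exists h; split => [y|]; rewrite big_nil mulr1.
  exists (falg_add (falg_mul h g) (falg_scale (- val h z) g)); split.
    by move=> y; rewrite big_cons /= gE -[\val h]/(sval h) mulNr -mulrBl mulrCA.
  case: chiM => chiD chiZ chiM _; rewrite chiD chiM chiZ chig big_cons.
  by rewrite mulNr -mulrBl mulrCA.
have [g [gE chig]] := key S.
have : chi g = 0.
  apply: multiplicative0 => // y; rewrite gE.
  have [yS|yS] := boolP (y \in S); last by rewrite hS// mul0r.
  by rewrite (big_rem y)//= subrr mul0r mulr0.
rewrite chig => /eqP; rewrite mulf_eq0 => /orP[/eqP|]; first by left.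
elim: (S) => [|z s IH]; first by rewrite big_nil oner_eq0.
rewrite big_cons mulf_eq0 subr_eq0 => /orP[/eqP -> |//].
by right; exists z.
Qed.

Lemma continuum_disjoint_open_of_family (h : R -> A) :
  (forall t y, normc (val (h t) y) <= 1 / 2) ->
  (forall s t, s != t -> exists S : seq G, forall y, y \notin S ->
     val (h s) y * val (h t) y = 0) ->
  (forall t, exists2 chi : {ptws A -> C^o}, multiplicative_functionals chi &
     normc (chi (h t)) = 1) ->
  continuum_disjoint_open R (character_space A).
Proof.
move=> h2 hdisj hchi.
pose eval t (chi : character_space A) := (val chi : {ptws A -> C^o}) (h t).
pose U t := [set chi : character_space A | 1 / 2 < normc (eval t chi)].
exists U; split.
- move=> t; have : continuous (eval t).
    move=> chi; apply: (@continuous_comp _ _ _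
        (fun psi : character_space A => val psi : {ptws A -> C^o})
        (fun psi : {ptws A -> C^o} => psi (h t))).
      exact: initial_continuous.
    exact: (@proj_continuous A (fun _ => C^o) (h t)).
  by move=> /continuousP/(_ _ (@open_normc_gt (1 / 2))).
- move=> t; have [chi chiM chi1] := hchi t.
  exists (SigSub (mem_set chiM) : character_space A).
  by rewrite /U /eval /= chi1; lra.
- move=> s t _ _ [chi [/= chis chit]]; apply/eqP/negPn/negP => st.
  have chiM : multiplicative_functionals (val chi) := set_valP chi.
  have [S hS] := hdisj s t st.
  have chist : (val chi : {ptws A -> C^o}) (falg_mul (h s) (h t)) =
    (val chi : {ptws A -> C^o}) (h s) * (val chi : {ptws A -> C^o}) (h t) by case: chiM.
  have gt4 : 1 / 4 < normc ((val chi : {ptws A -> C^o}) (falg_mul (h s) (h t))).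
    rewrite chist normcM (_ : 1 / 4 = 1 / 2 * (1 / 2)); last by field.
    by apply: ltr_pM => //; rewrite divr_ge0.
  have [c0|[y cy]] := multiplicative_finite_range (h := falg_mul (h s) (h t)) chiM hS.
    by rewrite c0 normc0 ltNge divr_ge0 in gt4.
  rewrite cy /= normcM in gt4.
  suff : normc (val (h s) y) * normc (val (h t) y) <= 1 / 2 * (1 / 2).
    move=> le4; have := lt_le_trans gt4 le4.
    by rewrite (_ : 1 / 4 = 1 / 2 * (1 / 2)) ?ltxx//; field.
  by apply: ler_pM; rewrite ?normc_ge0 ?h2.
Qed.

End disjoint_open_sets.

(** * A continuum of almost disjoint sets of integers, and block weights *)

Section almost_disjoint.
Variable R : realType.

(** Codes of the points [(n, floor (n t))]. Once [n |s - t| > 1] the points for [s] and [t] differ,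
    so distinct reals share only finitely many codes. *)
Definition almost_disjoint (t : R) : set nat :=
  [set m | exists n : nat, m = pickle (n, Num.floor (n%:R * t))].

Lemma almost_disjoint_unbounded t M : exists2 m, almost_disjoint t m & (M <= m)%N.
Proof.
apply: contrapT => no.
have lt n : (pickle (n, Num.floor (n%:R * t)) < M)%N.
  rewrite ltnNge; apply/negP => Mn; apply: no.
  by exists (pickle (n, Num.floor (n%:R * t))) => //; exists n.
have : injective (fun i : 'I_M.+1 => Ordinal (lt i)).
  by move=> i j [/(pcan_inj pickleK)[/ord_inj]].
by move=> /leq_card; rewrite !card_ord ltnn.
Qed.

Lemma almost_disjointP s t : s != t -> exists M, forall m, (M <= m)%N ->
  ~ (almost_disjoint s m /\ almost_disjoint t m).
Proof.
move=> st; have st0 : 0 < `|s - t| by rewrite normr_gt0 subr_eq0.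
pose N := Num.bound `|s - t|^-1.
exists (\max_(n < N) pickle (val n, Num.floor (n%:R * s))).+1%N => m Mm.
move=> [[n mE] [n']]; rewrite mE => /(pcan_inj pickleK) [<- fl].
have nN : (n < N)%N.
  rewrite ltnNge; apply/negP => Nn.
  have : 1 < n%:R * `|s - t|.
    rewrite -ltr_pdivrMr// mul1r; apply: lt_le_trans (archi_boundP _) _.
      by rewrite invr_ge0 ltW.
    by rewrite ler_nat.
  rewrite -[n%:R in X in _ < X -> _]normr_nat -normrM mulrBr.
  have := floor_le_tmp (n%:R * s); have := lt_succ_floor (n%:R * s).
  have := floor_le_tmp (n%:R * t); have := lt_succ_floor (n%:R * t).
  rewrite fl intrD; set F := _%:~R => *.
  have : `|n%:R * s - n%:R * t| <= 1 by rewrite ler_norml; lra.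
  lra.
move: Mm; rewrite ltnNge => /negP; apply.
rewrite mE; exact: (@leq_bigmax _ (fun i : 'I_N => pickle (val i, Num.floor (i%:R * s)))
  (Ordinal nN)).
Qed.

(** With [j] half of [m], one factor [j + 4] together with the powers of two is at most [2 ^ j], and
    the remaining [(j + 4) ^ n] is at most [2 ^ j] by induction. *)
Lemma expn_dominates n : exists M, forall m, (M <= m)%N -> ((m + 4) ^ n <= 2 ^ m)%N.
Proof.
elim: n => [|n [M IH]]; first by exists 0%N => m _; rewrite expn0 expn_gt0.
exists (2 * (M + 2 * n + 12)).+1%N => m Mm.
pose j := m./2; have mj := odd_double_half m.
have [Mj nj] : (M <= j)%N /\ (2 * n + 12 <= j)%N by lia.
have lin : (2 ^ n.+1 * (j + 4) <= 2 ^ j)%N.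
  have -> : j = (n.+1 + (j - n.+1))%N by lia.
  rewrite expnD leq_mul2l expn_eq0 /=.
  have : (j - n.+1 - 1 < 2 ^ (j - n.+1 - 1))%N by rewrite ltn_expl.
  have -> : (2 ^ (j - n.+1) = 2 * 2 ^ (j - n.+1 - 1))%N.
    by rewrite -expnS; congr (2 ^ _)%N; lia.
  lia.
apply: (@leq_trans ((2 * (j + 4)) ^ n.+1)); first by rewrite leq_exp2r//; lia.
rewrite expnMn [((j + 4) ^ n.+1)%N]expnS mulnA.
apply: (@leq_trans (2 ^ j * 2 ^ j)); first by apply: leq_mul => //; exact: IH.
by rewrite -expnD leq_exp2l//; lia.
Qed.

(** [trunc_log 4 k] is the block containing [k]. The shift by 4 keeps every weight at most 1/4, as
    positive definiteness of the Riesz product requires. *)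
Definition block_coef (t : R) (k : nat) : R :=
  if `[< almost_disjoint t (trunc_log 4 k) >] then ((trunc_log 4 k + 4)%:R)^-1 else 0.

Lemma block_coef_ge0 t k : 0 <= block_coef t k.
Proof. by rewrite /block_coef; case: ifP => // _; rewrite invr_ge0. Qed.

Lemma block_coef_le t k M : (4 ^ M <= k)%N -> block_coef t k <= ((M + 4)%:R)^-1.
Proof.
move=> Mk; rewrite /block_coef; case: ifP => // _.
rewrite lef_pV2 ?posrE ?ltr0n ?addn_gt0 ?orbT// ler_nat leq_add2r.
by rewrite trunc_log_max.
Qed.

Lemma block_coef_le4 t k : block_coef t k <= 1 / 4.
Proof.
rewrite /block_coef; case: ifP => _; last by rewrite divr_ge0.
by rewrite div1r lef_pV2 ?posrE ?ltr0n ?addn_gt0 ?orbT// ler_nat leq_addl.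
Qed.

Lemma block_coef_disjoint s t : s != t ->
  exists N, forall k, (N <= k)%N -> block_coef s k * block_coef t k = 0.
Proof.
move=> /almost_disjointP[M MP]; exists (4 ^ M)%N => k Mk; rewrite /block_coef.
have := MP (trunc_log 4 k) (trunc_log_max (isT : (1 < 4)%N) Mk).
by case: asboolP => [ks|_]; case: asboolP => [kt|_] no; rewrite ?mul0r ?mulr0//;
  exfalso; apply: no.
Qed.

End almost_disjoint.

(** * Riesz products with block weights *)

Section block_riesz.
Variables (R : realType) (G : groupType) (H : set G).
Local Notation C := R[i].
Variables (x : nat -> G) (W : nat -> seq G).
Hypothesis xW : dissociate H x W.
Hypothesis H1 : H 1%g.
Hypothesis HM : forall y z, H y -> H z -> H (y * z)%g.
Hypothesis Hc : forall y z, H y -> H z -> commute y z.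

Definition block_riesz (t : R) (y : G) : C := ((riesz x W (block_coef t) y)%:C)%C.

Let block_riesz1 t : block_riesz t 1%g = 1.
Proof. by rewrite /block_riesz (riesz1 xW). Qed.

Lemma block_riesz_pd t : positive_definite (block_riesz t).
Proof.
by apply: (riesz_positive_definite xW) => // k;
  [exact: block_coef_ge0|exact: block_coef_le4].
Qed.

(** Pick a block [m] in the set of [t] with [(m + 4) ^ n <= 2 ^ m], and take [l = 2 ^ m]. Its first
    [4 ^ m = l ^ 2] indices, starting at [K], have coefficients whose [n]-th powers are at least
    [1 / l], so these sum to at least [l]. The resulting bound is independent of [n]. *)
Lemma block_riesz_lower t n d r :
  fs_le (fun y => block_riesz t y ^+ n + d * (y == 1%g)%:R) r ->
  (2 * (expR 1 + 1))^-1 <= r.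
Proof.
have [M MP] := expn_dominates n.
have [m tm Mm] := almost_disjoint_unbounded t M.
pose K := (4 ^ m)%N; pose c := block_coef t.
have c0 := block_coef_ge0 t.
have coef0 k : 0 <= riesz_coef x c k by exact: riesz_coef_ge0.
have ck k : (k < 4 ^ m)%N -> c (K + k)%N = ((m + 4)%:R)^-1.
  move=> km; have e : trunc_log 4 (K + k) = m.
    by apply: trunc_log_eq => //; rewrite expnS /K; lia.
  by rewrite /c /block_coef e; case: asboolP.
have shift k y : y \in W (K + k)%N ->
    block_riesz t (x (K + k)%N * y)%g ^+ n =
      ((riesz_coef x c (K + k)%N ^+ n)%:C)%C * block_riesz t y ^+ n /\
    block_riesz t ((x (K + k)%N)^-1 * y)%g ^+ n =
      ((riesz_coef x c (K + k)%N ^+ n)%:C)%C * block_riesz t y ^+ n.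
  move=> yW; have [s s'] := riesz_shift xW c yW.
  by rewrite /block_riesz s s' -!rmorphXn -!rmorphM /= -!exprMn.
apply: (@fs_le_lower_bound R G (fun k => x (K + k)%N) (fun k => W (K + k)%N)
    _ _ _ _ (fun k => riesz_coef x c (K + k)%N ^+ n) (2 ^ m)%N).
- exact: dissociate1 xW _.
- by move=> k y yW; rewrite addnS; exact: dissociate_mem xW _ _ yW.
- move=> k y yW; have [xy xy'] := dissociate_notin xW yW.
  have W1 := dissociate1 xW (K + k).
  by split; [apply: contraNneq xy|apply: contraNneq xy'] => ->.
- by rewrite expn_gt0.
- by move=> k; rewrite exprn_ge0.
- by rewrite block_riesz1 expr1n.
- by move=> k y yW; case: (shift k y yW).
- by move=> k y yW; case: (shift k y yW).
- have e2 : ((2 ^ m) ^ 2 = 4 ^ m)%N by rewrite -expnM mulnC expnM.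
  have le k : (k < (2 ^ m) ^ 2)%N -> ((2 ^ m)%N%:R)^-1 <= riesz_coef x c (K + k)%N ^+ n.
    rewrite e2 => km; apply: (@le_trans _ _ (c (K + k)%N ^+ n)); last first.
      by apply: lerXn2r; rewrite ?nnegrE ?coef0 ?c0//; exact: riesz_coef_ge.
    rewrite ck// exprVn -natrX lef_pV2 ?posrE ?ltr0n ?expn_gt0 ?addn_gt0 ?orbT//.
    by rewrite ler_nat MP.
  apply: (@le_trans _ _ (\sum_(k < (2 ^ m) ^ 2) ((2 ^ m)%N%:R)^-1)); last first.
    by apply: ler_sum => k _; exact: le.
  by rewrite sumr_const card_ord -[leRHS]mulr_natr (natrX _ (2 ^ m)%N 2) expr2 mulKf.
Qed.

(** Outside the finite list [W (4 ^ M)] only weights of size at most [1 / (M + 4) <= e / 4] matter,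
    so the values are at most [e / 2]. *)
Lemma block_riesz_c0 t : c0_set (block_riesz t).
Proof.
move=> e e0; pose M := Num.bound (4 / e).
apply: (@sub_finite_set _ _ [set` W (4 ^ M)%N]); last exact: finite_seq.
move=> y /=; apply: contraTT => yW.
have y1 : y != 1%g by apply: contraNneq yW => ->; exact: dissociate1 xW _.
have := riesz_ge0_le1 xW (block_coef_ge0 t) (block_coef_le4 t) y => /andP[f0 _].
rewrite norm_normc /block_riesz normcR// lecR -ltNge.
apply: (@le_lt_trans _ _ (e / 2)); last by lra.
apply: (riesz_le xW (block_coef_ge0 t) (block_coef_le4 t) _ _ y1 yW).
  by rewrite divr_ge0// ltW.
move=> k Mk; have := block_coef_le t Mk.
have M0 : 0 < (M + 4)%:R :> R by rewrite ltr0n addn_gt0 orbT.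
have : ((M + 4)%:R)^-1 <= e / 4.
  rewrite -[leRHS]invrK lef_pV2 ?posrE ?invr_gt0 ?divr_gt0// invf_div.
  apply: le_trans (ltW (archi_boundP _)) _; first by rewrite divr_ge0// ltW.
  by rewrite ler_nat leq_addr.
lra.
Qed.

Let delta (y : G) : C := (y == 1%g)%:R.

Lemma block_riesz_deltaE t y : block_riesz t y - delta y =
  if y == 1%g then 0 else block_riesz t y.
Proof.
rewrite /delta; have [->|_] := eqVneq; first by rewrite block_riesz1 subrr.
by rewrite subr0.
Qed.

Lemma normc_block_riesz t y : normc (block_riesz t y - delta y) <= 1 / 2.
Proof.
rewrite block_riesz_deltaE; have [_|y1] := eqVneq; first by rewrite normc0 divr_ge0.
have /andP[f0 _] := riesz_ge0_le1 xW (block_coef_ge0 t) (block_coef_le4 t) y.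
rewrite normcR//; apply: (riesz_le_half xW) => //.
  exact: block_coef_ge0.
exact: block_coef_le4.
Qed.

Lemma block_riesz_disjoint s t : s != t -> exists S : seq G, forall y, y \notin S ->
  (block_riesz s y - delta y) * (block_riesz t y - delta y) = 0.
Proof.
move=> /block_coef_disjoint[N Nst]; exists (W N) => y yW.
rewrite !block_riesz_deltaE; case: eqP => _; first by rewrite mul0r.
by rewrite -rmorphM /= (riesz_disjoint xW Nst yW).
Qed.

(** Stated for any algebra inside B(G) containing the Riesz products and the point mass, to cover
    both cases. The restricted character is nonzero since it has modulus 1 at [block_riesz t]. *)
Lemma block_riesz_continuum (A : function_algebra C G) :
  (falg_set A `<=` @fourier_stieltjes_set R G) ->
  (forall t, falg_set A (block_riesz t)) -> falg_set A delta ->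
  continuum_disjoint_open R (character_space A).
Proof.
move=> AF Af Ad.
have Ah t : falg_set A (fun y => block_riesz t y - delta y).
  rewrite (_ : (fun y => _) = fun y => block_riesz t y + (-1) * delta y).
    by apply: falgD => //; exact: falgZ.
  by apply/funext => y; rewrite mulN1r.
apply: (@continuum_disjoint_open_of_family _ _ A (fun t => SigSub (mem_set (Ah t)))).
- exact: normc_block_riesz.
- exact: block_riesz_disjoint.
move=> t.
have d0 : 0 < (2 * (expR 1 + 1))^-1 :> R.
  by rewrite invr_gt0 mulr_gt0// addr_gt0// expR_gt0.
have [phi [phiD phiM phiZ phid phif]] :=
  exists_fs_character (block_riesz_pd t) (block_riesz1 t) d0 (@block_riesz_lower t).
have Fval (g : A) : fourier_stieltjes_set (val g) by apply/AF/set_valP.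
have phih : phi (fun y => block_riesz t y - delta y) = phi (block_riesz t).
  rewrite (_ : (fun y => _) = fun y => block_riesz t y + (-1) * delta y).
    rewrite phiD; last 2 first.
    - exact: AF.
    - by apply/fourier_stieltjesZ/AF.
    by rewrite phiZ ?phid ?mulr0 ?addr0//; exact: AF.
  by apply/funext => y; rewrite mulN1r.
exists (fun g : A => phi (val g)); last by rewrite /= phih.
split.
- by move=> g h; exact: phiD.
- by move=> a g; exact: phiZ.
- by move=> g h; exact: phiM.
- exists (SigSub (mem_set (Af t))); apply/eqP => /= phi0.
  by have := phif; rewrite phi0 normc0 => /eqP; rewrite eq_sym oner_eq0.
Qed.

End block_riesz.

Lemma delta1_c0 (R : realType) (G : groupType) :
  c0_set (fun y : G => (y == 1%g)%:R : R[i]).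
Proof.
move=> e e0; apply: (@sub_finite_set _ _ [set 1%g]); last exact: finite_set1.
move=> y /=; case: eqP => // _; rewrite normr0 lecR => e0'.
by rewrite leNgt e0 in e0'.
Qed.

Theorem theorem2p4 (R : realType) (G : groupType) (H : set G)
    (Hgroup : group_closed (mem H))
    (Habelian : {in H &, forall x y, commute x y})
    (Hinfinite : infinite_set H) :
  (continuum_disjoint_open R (character_space (fourier_stieltjes_c0 R G)) /\
   ~ separable (character_space (fourier_stieltjes_c0 R G))) /\
  (continuum_disjoint_open R (character_space (fourier_stieltjes R G)) /\
   ~ separable (character_space (fourier_stieltjes R G))).
Proof.
have [x [W xW]] := exists_dissociate_sequence Hgroup Habelian Hinfinite.
have H1 := group_closed1P Hgroup.
have HM := group_closedMP Hgroup.
have Hc := abelian_commute Habelian.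
have pd t := block_riesz_pd xW H1 HM Hc t.
have dF : fourier_stieltjes_set (fun y : G => (y == 1%g)%:R : R[i]).
  exact/fourier_stieltjes_pd/positive_definite_delta1.
have c0 : continuum_disjoint_open R (character_space (fourier_stieltjes_c0 R G)).
  apply: (block_riesz_continuum xW H1 HM Hc).
  - by move=> g [].
  - by move=> t; split; [exact/fourier_stieltjes_pd/pd|exact: block_riesz_c0 xW _].
  - by split; [|exact: delta1_c0].
have c : continuum_disjoint_open R (character_space (fourier_stieltjes R G)).
  apply: (block_riesz_continuum xW H1 HM Hc) => // t.
  exact/fourier_stieltjes_pd/pd.
split; split => //.
  exact: continuum_disjoint_open_not_separable c0.
exact: continuum_disjoint_open_not_separable c.
Qed.
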